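(* Let $R$ be a commutative ring and let $d\in\mathbb N$. If $M$ is an $R$-valued $\mathsf{FI}$-module presented in degrees $\le d$, then there are $R$-modules $A_0,\dots,A_d$ such that there is an isomorphism of $R$-modules \[ M_n \;\cong\; \bigoplus_{\ell=0}^{d} A_\ell^{\oplus \left(\binom{n}{\ell}-\binom{n}{\ell-1}\right)} \] for all $n\ge 2d-1$.
   Context: $\mathsf{FI}$ is the category of finite sets and injections; $[n]=\{1,\dots,n\}$. An $R$-valued $\mathsf{FI}$-module is a functor $M\colon \mathsf{FI}\to \mathrm{Mod}_R$, and $M_n=M([n])$. Write $R\,\mathsf{FI}(a,-)$ for the free $\mathsf{FI}$-module $S\mapsto R\cdot\{\text{injections }[a]\to S\}$. $M$ is presented in degrees $\le d$ if it is isomorphic to the cokernel of a map $\bigoplus_{j\in J} R\,\mathsf{FI}(b_j,-)\to\bigoplus_{i\in I} R\,\mathsf{FI}(a_i,-)$ of $\mathsf{FI}$-modules with all $a_i\le d$ and $b_j\le d$; the index sets $I,J$ may be infinite. By convention $\binom{n}{-1}=0$. *)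

(* Defs.v *)
From HB Require Import structures.
From mathcomp Require Import all_boot all_order all_algebra.
From mathcomp Require Import generic_quotient ring_quotient.
From mathcomp Require Import boolp classical_sets functions cardinality.

Set Implicit Arguments.
Unset Strict Implicit.
Unset Printing Implicit Defensive.

Import GRing.Theory.
Local Open Scope classical_set_scope.
Local Open Scope ring_scope.
Local Open Scope quotient_scope.

Definition lmod_iso (R : pzRingType) (V W : lmodType R) : Prop :=
  exists f : {linear V -> W}, bijective f.

(** The index type is arbitrary (possibly infinite): elements are the dependent
    functions with finite support. *)
Section DirectSum.
Variables (R : pzRingType) (I : Type) (V : I -> lmodType R).

Record dsum : Type := DSum {
  dsum_fun :> forall i, V i;
  dsum_finite : finite_set [set i | dsum_fun i != 0] }.

Implicit Types x y z : dsum.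

Lemma dsumP x y : (forall i, x i = y i) -> x = y.
Proof.
case: x y => [f hf] [g hg] /= fg; have {}fg : f = g by exact: functional_extensionality_dep.
by rewrite -fg in hg *; congr DSum; exact: Prop_irrelevance.
Qed.

HB.instance Definition _ := gen_eqMixin dsum.
HB.instance Definition _ := gen_choiceMixin dsum.

Fact dsum0_finite : finite_set [set i | (0 : V i) != 0].
Proof. by apply: sub_finite_set (finite_set0 I) => i /=; rewrite eqxx. Qed.
Definition dsum0 := DSum dsum0_finite.

Fact dsumN_finite x : finite_set [set i | - x i != 0].
Proof. by apply: sub_finite_set (dsum_finite x) => i /=; rewrite oppr_eq0. Qed.
Definition dsumN x := DSum (dsumN_finite x).

Fact dsumD_finite x y : finite_set [set i | x i + y i != 0].
Proof.
apply: (@sub_finite_set _ _ ([set i | x i != 0] `|` [set i | y i != 0])).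
  move=> i /=; have [->|xi0 _] := eqVneq (x i) 0; last by left.
  by rewrite add0r; right.
by rewrite finite_setU; split; exact: dsum_finite.
Qed.
Definition dsumD x y := DSum (dsumD_finite x y).

Fact dsumZ_finite (a : R) x : finite_set [set i | a *: x i != 0].
Proof.
apply: sub_finite_set (dsum_finite x) => i /=.
by apply: contra => /eqP->; rewrite scaler0.
Qed.
Definition dsumZ a x := DSum (dsumZ_finite a x).

Fact dsum_addA : associative dsumD.
Proof. by move=> x y z; apply: dsumP => i /=; rewrite addrA. Qed.
Fact dsum_addC : commutative dsumD.
Proof. by move=> x y; apply: dsumP => i /=; rewrite addrC. Qed.
Fact dsum_add0 : left_id dsum0 dsumD.
Proof. by move=> x; apply: dsumP => i /=; rewrite add0r. Qed.
Fact dsum_addN : left_inverse dsum0 dsumN dsumD.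
Proof. by move=> x; apply: dsumP => i /=; rewrite addNr. Qed.

HB.instance Definition _ :=
  GRing.isZmodule.Build dsum dsum_addA dsum_addC dsum_add0 dsum_addN.

Fact dsum_scaleA a b x : dsumZ a (dsumZ b x) = dsumZ (a * b) x.
Proof. by apply: dsumP => i /=; rewrite scalerA. Qed.
Fact dsum_scale1 : left_id 1 dsumZ.
Proof. by move=> x; apply: dsumP => i /=; rewrite scale1r. Qed.
Fact dsum_scaleDr : right_distributive dsumZ +%R.
Proof. by move=> a x y; apply: dsumP => i /=; rewrite scalerDr. Qed.
Fact dsum_scaleDl x : {morph dsumZ^~ x : a b / a + b}.
Proof. by move=> a b; apply: dsumP => i /=; rewrite scalerDl. Qed.

HB.instance Definition _ := GRing.Zmodule_isLmodule.Build R dsum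
  dsum_scaleA dsum_scale1 dsum_scaleDr dsum_scaleDl.

End DirectSum.

Section DirectSumMap.
Variables (R : pzRingType) (I : Type) (V W : I -> lmodType R).
Variable f : forall i, {linear V i -> W i}.

Fact dsum_map_finite (x : dsum V) : finite_set [set i | f i (x i) != 0].
Proof.
apply: sub_finite_set (dsum_finite x) => i /=.
by apply: contra => /eqP->; rewrite linear0.
Qed.
Definition dsum_map (x : dsum V) : dsum W := DSum (dsum_map_finite x).

Fact dsum_map_is_linear : linear dsum_map.
Proof. by move=> a x y; apply: dsumP => i /=; rewrite linearP. Qed.
HB.instance Definition _ :=
  GRing.isLinear.Build R (dsum V) (dsum W) _ dsum_map dsum_map_is_linear.

End DirectSumMap.

Section Cokernel.
Variables (R : pzRingType) (V W : lmodType R) (f : {linear V -> W}).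

Definition im_pred : {pred W} := fun y => `[< exists x, f x = y >].

Fact im_pred_zmod_closed : zmod_closed im_pred.
Proof.
split; first by apply/asboolP; exists 0; rewrite linear0.
move=> _ _ /asboolP[x <-] /asboolP[y <-].
by apply/asboolP; exists (x - y); rewrite linearB.
Qed.
HB.instance Definition _ := GRing.isZmodClosed.Build W im_pred im_pred_zmod_closed.

Definition coker : Type := Quotient.quot im_pred.
HB.instance Definition _ := GRing.Zmodule.on coker.

Definition coker_pi (y : W) : coker := \pi_(Quotient.quot im_pred) y.

Lemma coker_piP x y : coker_pi x = coker_pi y <-> exists v, f v = x - y.
Proof.
have E : (coker_pi x == coker_pi y) = (x - y \in im_pred).
  by rewrite /coker_pi Quotient.idealrBE.
split=> [/eqP|[v xy]]; first by rewrite E => /asboolP.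
by apply/eqP; rewrite E; apply/asboolP; exists v.
Qed.

Lemma coker_pi_surj (q : coker) : exists y, coker_pi y = q.
Proof. by exists (repr (q : Quotient.quot im_pred)); exact: reprK. Qed.

Lemma coker_piD x y : coker_pi (x + y) = coker_pi x + coker_pi y.
Proof. exact: (raddfD \pi_(Quotient.quot im_pred)). Qed.

Definition coker_repr (q : coker) : W := repr (q : Quotient.quot im_pred).

Lemma coker_reprK q : coker_pi (coker_repr q) = q.
Proof. exact: reprK. Qed.

Definition coker_scale (a : R) (q : coker) : coker := coker_pi (a *: coker_repr q).

Lemma coker_piZ a y : coker_pi (a *: y) = coker_scale a (coker_pi y).
Proof.
apply/coker_piP; have /coker_piP[v fv] := coker_reprK (coker_pi y).
by exists (a *: - v); rewrite linearZ_LR linearN fv opprB scalerBr.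
Qed.

Fact coker_scaleA a b q : coker_scale a (coker_scale b q) = coker_scale (a * b) q.
Proof. by have [y <-] := coker_pi_surj q; rewrite -!coker_piZ scalerA. Qed.
Fact coker_scale1 : left_id 1 coker_scale.
Proof. by move=> q; have [y <-] := coker_pi_surj q; rewrite -coker_piZ scale1r. Qed.
Fact coker_scaleDr : right_distributive coker_scale +%R.
Proof.
move=> a q r; have [x <-] := coker_pi_surj q; have [y <-] := coker_pi_surj r.
by rewrite -!(coker_piD, coker_piZ) scalerDr.
Qed.
Fact coker_scaleDl q : {morph coker_scale^~ q : a b / a + b}.
Proof.
by move=> a b; have [x <-] := coker_pi_surj q; rewrite -!(coker_piD, coker_piZ) scalerDl.
Qed.
HB.instance Definition _ := GRing.Zmodule_isLmodule.Build R coker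
  coker_scaleA coker_scale1 coker_scaleDr coker_scaleDl.

Fact coker_pi_is_linear : linear coker_pi.
Proof. by move=> a x y; rewrite coker_piD coker_piZ. Qed.
HB.instance Definition _ :=
  GRing.isLinear.Build R W coker _ coker_pi coker_pi_is_linear.

End Cokernel.

Arguments coker_pi {R V W} f y.

Section CokernelMap.
Variables (R : pzRingType) (V W V' W' : lmodType R).
Variables (f : {linear V -> W}) (f' : {linear V' -> W'}).
Variables (u : {linear V -> V'}) (v : {linear W -> W'}).

Definition coker_map of (forall x, v (f x) = f' (u x)) :=
  fun q : coker f => coker_pi f' (v (coker_repr q)).

Hypothesis vf : forall x, v (f x) = f' (u x).

Lemma coker_mapE y : coker_map vf (coker_pi f y) = coker_pi f' (v y).
Proof.
apply/coker_piP; have /coker_piP[x fx] := coker_reprK (coker_pi f y).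
by exists (u x); rewrite -vf fx linearB.
Qed.

Fact coker_map_is_linear : linear (coker_map vf).
Proof.
move=> a q r; have [x <-] := coker_pi_surj q; have [y <-] := coker_pi_surj r.
by rewrite -linearP !coker_mapE !linearP.
Qed.
HB.instance Definition _ :=
  GRing.isLinear.Build R (coker f) (coker f') _ (coker_map vf) coker_map_is_linear.

End CokernelMap.

(** Morphisms of FI are injective finite functions, on which Leibniz equality is
    extensional. *)
Record inj (S T : finType) : Type := Inj {
  inj_ffun :> {ffun S -> T};
  injP : injectiveb inj_ffun }.

HB.instance Definition _ (S T : finType) := [isSub for @inj_ffun S T].
HB.instance Definition _ (S T : finType) := [Finite of inj S T by <:].

Lemma inj_injective (S T : finType) (f : inj S T) : injective f.
Proof. exact/injectiveP/injP. Qed.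

Lemma inj_ext (S T : finType) (f g : inj S T) : f =1 g -> f = g.
Proof. by move=> fg; apply/val_inj/ffunP. Qed.

Fact inj_id_subproof (S : finType) : injectiveb [ffun x : S => x].
Proof. by apply/injectiveP => x y; rewrite !ffunE. Qed.
Definition inj_id (S : finType) : inj S S := Inj (inj_id_subproof S).

Fact inj_comp_subproof (S T U : finType) (g : inj T U) (f : inj S T) :
  injectiveb [ffun x => g (f x)].
Proof. by apply/injectiveP => x y; rewrite !ffunE => /inj_injective/inj_injective. Qed.
Definition inj_comp (S T U : finType) (g : inj T U) (f : inj S T) : inj S U :=
  Inj (inj_comp_subproof g f).

Record FImod (R : comPzRingType) : Type := {
  fi_obj :> finType -> lmodType R;
  fi_map : forall S T : finType, inj S T -> {linear fi_obj S -> fi_obj T};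
  fi_map_id : forall (S : finType) (x : fi_obj S), fi_map (inj_id S) x = x;
  fi_map_comp : forall (S T U : finType) (g : inj T U) (f : inj S T) (x : fi_obj S),
    fi_map (inj_comp g f) x = fi_map g (fi_map f x) }.

Record FIhom (R : comPzRingType) (M N : FImod R) : Type := {
  fi_hom :> forall S : finType, {linear M S -> N S};
  fi_hom_natural : forall (S T : finType) (f : inj S T) (x : M S),
    fi_hom T (fi_map M f x) = fi_map N f (fi_hom S x) }.

Definition FIiso (R : comPzRingType) (M N : FImod R) : Prop :=
  exists (p : FIhom M N) (q : FIhom N M),
    forall S : finType, cancel (p S) (q S) /\ cancel (q S) (p S).

Section FreeFI.
Variables (R : comPzRingType) (a : nat).

(** A function on the finite set of injections [[a] -> S] stands for the formal
    linear combination [\sum_g v g * g]. *)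
Definition free_obj (S : finType) : lmodType R := {ffun inj 'I_a S -> R^o}.

Definition free_map (S T : finType) (f : inj S T) (v : free_obj S) : free_obj T :=
  [ffun h => \sum_(g : inj 'I_a S | inj_comp f g == h) v g].

Fact free_map_is_linear S T (f : inj S T) : linear (free_map f).
Proof.
move=> c x y; apply/ffunP => h; rewrite !ffunE scaler_sumr -big_split /=.
by apply: eq_bigr => g _; rewrite !ffunE.
Qed.
HB.instance Definition _ S T (f : inj S T) :=
  GRing.isLinear.Build R (free_obj S) (free_obj T) _ (free_map f) (free_map_is_linear f).

Fact free_map_id (S : finType) (x : free_obj S) : free_map (inj_id S) x = x.
Proof.
apply/ffunP => h; rewrite ffunE (big_pred1 h) // => g /=.
by congr (_ == _); apply: inj_ext => i; rewrite !ffunE.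
Qed.

Fact free_map_comp (S T U : finType) (g : inj T U) (f : inj S T) (x : free_obj S) :
  free_map (inj_comp g f) x = free_map g (free_map f x).
Proof.
apply/ffunP => h; rewrite !ffunE.
under [RHS]eq_bigr => k _ do rewrite ffunE.
rewrite (exchange_big_dep xpredT) //= big_mkcond /=.
apply: eq_bigr => e _.
have -> : inj_comp (inj_comp g f) e = inj_comp g (inj_comp f e).
  by apply: inj_ext => i; rewrite !ffunE.
case: ifP => [gfe|/negbT gfe].
  rewrite (big_pred1 (inj_comp f e)) // => k /=.
  by apply/andP/eqP => [[_ /eqP ->] //|->]; split.
by rewrite big_pred0 // => k; apply/andP => -[gk /eqP ek]; rewrite ek gk in gfe.
Qed.

Definition free_FI : FImod R :=
  {| fi_obj := free_obj; fi_map := fun S T f => free_map f;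
     fi_map_id := free_map_id; fi_map_comp := free_map_comp |}.

End FreeFI.

Section DirectSumFI.
Variables (R : comPzRingType) (I : Type) (M : I -> FImod R).

Definition dsum_FI_obj (S : finType) : lmodType R := dsum (fun i => M i S).

Definition dsum_FI_map (S T : finType) (f : inj S T) :
    {linear dsum_FI_obj S -> dsum_FI_obj T} :=
  dsum_map (fun i => fi_map (M i) f).

Fact dsum_FI_map_id (S : finType) (x : dsum_FI_obj S) : dsum_FI_map (inj_id S) x = x.
Proof. by apply: dsumP => i /=; rewrite fi_map_id. Qed.

Fact dsum_FI_map_comp (S T U : finType) (g : inj T U) (f : inj S T)
    (x : dsum_FI_obj S) :
  dsum_FI_map (inj_comp g f) x = dsum_FI_map g (dsum_FI_map f x).
Proof. by apply: dsumP => i /=; rewrite fi_map_comp. Qed.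

Definition dsum_FI : FImod R :=
  {| fi_obj := dsum_FI_obj; fi_map := dsum_FI_map;
     fi_map_id := dsum_FI_map_id; fi_map_comp := dsum_FI_map_comp |}.

End DirectSumFI.

Section CokernelFI.
Variables (R : comPzRingType) (M N : FImod R) (p : FIhom M N).

Definition coker_FI_obj (S : finType) : lmodType R := coker (p S).

Definition coker_FI_map (S T : finType) (f : inj S T) :
    {linear coker_FI_obj S -> coker_FI_obj T} :=
  coker_map (fun x => esym (fi_hom_natural p f x)).

Fact coker_FI_map_id (S : finType) (q : coker_FI_obj S) :
  coker_FI_map (inj_id S) q = q.
Proof. by have [y <-] := coker_pi_surj q; rewrite /= coker_mapE fi_map_id. Qed.

Fact coker_FI_map_comp (S T U : finType) (g : inj T U) (f : inj S T)
    (q : coker_FI_obj S) :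
  coker_FI_map (inj_comp g f) q = coker_FI_map g (coker_FI_map f q).
Proof. by have [y <-] := coker_pi_surj q; rewrite /= !coker_mapE fi_map_comp. Qed.

Definition coker_FI : FImod R :=
  {| fi_obj := coker_FI_obj; fi_map := coker_FI_map;
     fi_map_id := coker_FI_map_id; fi_map_comp := coker_FI_map_comp |}.

End CokernelFI.

Definition presented_in_degrees (R : comPzRingType) (d : nat) (M : FImod R) : Prop :=
  exists (I J : Type) (a : I -> nat) (b : J -> nat)
    (p : FIhom (dsum_FI (fun j : J => free_FI R (b j)))
               (dsum_FI (fun i : I => free_FI R (a i)))),
    [/\ forall i, (a i <= d)%N, forall j, (b j <= d)%N & FIiso M (coker_FI p)].

(** $\binom{n}{l}-\binom{n}{l-1}$ with $\binom{n}{-1}=0$.  By [leq_bin_succ] the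
    subtraction is not truncated when [l <= d] and [2 * d - 1 <= n]. *)
Definition binom_diff (n l : nat) : nat :=
  ('C(n, l) - (if l is l'.+1 then 'C(n, l') else 0))%N.

Lemma leq_bin_succ (d n l : nat) : (2 * d - 1 <= n)%N -> (l.+1 <= d)%N ->
  ('C(n, l) <= 'C(n, l.+1))%N.
Proof.
rewrite leq_subLR add1n mul2n => dn ld.
rewrite -(leq_pmul2l (ltn0Sn l)) mul_bin_left leq_mul2r.
have : (l.+1.*2 <= n.+1)%N by rewrite (leq_trans _ dn) // leq_double.
rewrite doubleS ltnS -addnn => ln; apply/orP; right.
by rewrite leq_subRL ?addnS // (leq_trans _ ln) // (leq_trans (leq_addr l l)).
Qed.

(* Main.v *)
Require Import Defs.
From HB Require Import structures.
From mathcomp Require Import all_boot all_order all_algebra.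
From mathcomp Require Import zify.
From mathcomp Require Import boolp classical_sets cardinality.

(** Write [W k n] for the words of length [k] without repetition in the letters
    [0 .. n-1].  The module [M_n] is the tensor product of [M] with the right
    FI-module [k |-> R[W k n]], and a presentation in degrees [<= d] only sees
    the degrees [k <= d] of the latter.  So it suffices to decompose this
    truncated right module, for [2 d <= n + 1], into [binom_diff n l] copies of
    a right module [B_l] that does not depend on [n].  In degree [k >= l], [B_l]
    is free on the permutations of [k] letters; deleting a position standardizes
    the word, except that deleting one of the [l] smallest letters gives [0].

    A copy of [B_l] in [k |-> R[W k n]] is given by [l] disjoint, non-crossing
    pairs of letters: put the difference of the two letters of each pair at the
    first [l] positions, followed by an element [u] of [R[W (k - l) (n - 2 l)]]
    in the remaining letters which is invariant under all deletions.

    - Two words with the same standardization are connected by steps replacing a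
      letter by an adjacent unused one, that is, they differ by words starting
      with a pair.  By induction these copies span, and as their number is given
      by ballot numbers, the ranks agree and the sum is direct.
    - The invariant elements [u] exist by induction on the degree: the deletions
      of the increasing word differ from [u] in lower degree by a compatible
      family in the summands [B_l], [l > 0], and every compatible family in [B_l]
      is filled by appending a largest letter. *)

Set Implicit Arguments.
Unset Strict Implicit.
Unset Printing Implicit Defensive.

Import GRing.Theory Defs.
Local Open Scope classical_set_scope.
Local Open Scope ring_scope.

Notation "g \oi f" := (inj_comp g f) (at level 50, format "g  \oi  f").
Notation word k n := (inj 'I_k 'I_n).

(** * Words without repetition *)

Section Injections.

Lemma inj_compE (S T U : finType) (g : inj T U) (f : inj S T) x : (g \oi f) x = g (f x).
Proof. by rewrite ffunE. Qed.

Lemma inj_idE (S : finType) (x : S) : inj_id S x = x.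
Proof. by rewrite ffunE. Qed.

Lemma inj_compA (S T U V : finType) (h : inj U V) (g : inj T U) (f : inj S T) :
  h \oi (g \oi f) = h \oi g \oi f.
Proof. by apply: inj_ext => x; rewrite !inj_compE. Qed.

Lemma inj_comp_id (S T : finType) (f : inj S T) : f \oi inj_id S = f.
Proof. by apply: inj_ext => x; rewrite inj_compE inj_idE. Qed.

Lemma inj_id_comp (S T : finType) (f : inj S T) : inj_id T \oi f = f.
Proof. by apply: inj_ext => x; rewrite inj_compE inj_idE. Qed.

Lemma inj_comp_inj (S T U : finType) (g : inj T U) (f f' : inj S T) :
  g \oi f = g \oi f' -> f = f'.
Proof.
move=> E; apply: inj_ext => x; apply: (@inj_injective _ _ g).
by rewrite -!inj_compE E.
Qed.

Lemma word_leq k n : word k n -> (k <= n)%N.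
Proof.
by move=> f; have := leq_card _ (@inj_injective _ _ f); rewrite !card_ord.
Qed.

Lemma word_inv k (s : word k k) : exists t, s \oi t = inj_id _ /\ t \oi s = inj_id _.
Proof.
have si := @inj_injective _ _ s.
have ti : injectiveb [ffun x => invF si x].
  apply/injectiveP => x y; rewrite !ffunE => /(congr1 s).
  by rewrite !(f_invF si).
exists (Inj ti); split; apply: inj_ext => x; rewrite !inj_compE inj_idE !ffunE.
  by rewrite (f_invF si).
by rewrite (invF_f si).
Qed.

Fact skip_subproof k (p : 'I_k.+1) : injectiveb [ffun i : 'I_k => lift p i].
Proof. by apply/injectiveP => i j; rewrite !ffunE; apply: lift_inj. Qed.
Definition skip k (p : 'I_k.+1) : word k k.+1 := Inj (skip_subproof p).

Lemma skipE k (p : 'I_k.+1) i : skip p i = lift p i.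
Proof. by rewrite ffunE. Qed.

Fact extend_subproof k n (p : 'I_k.+1) (y : 'I_n.+1) (w : word k n) :
  injectiveb [ffun i => if unlift p i is Some j then lift y (w j) else y].
Proof.
apply/injectiveP => i j; rewrite !ffunE.
case: unliftP => [i' ->|->]; case: unliftP => [j' ->|->] //.
- by move=> /lift_inj/inj_injective->.
- by move=> /eqP; rewrite eq_sym (negPf (neq_lift _ _)).
- by move=> /eqP; rewrite (negPf (neq_lift _ _)).
Qed.
Definition extend k n (p : 'I_k.+1) (y : 'I_n.+1) (w : word k n) : word k.+1 n.+1 :=
  Inj (extend_subproof p y w).

Lemma extend_at k n (p : 'I_k.+1) (y : 'I_n.+1) (w : word k n) : extend p y w p = y.
Proof. by rewrite ffunE unlift_none. Qed.

Lemma extend_lift k n (p : 'I_k.+1) (y : 'I_n.+1) (w : word k n) i :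
  extend p y w (lift p i) = lift y (w i).
Proof. by rewrite ffunE liftK. Qed.

Lemma eq_extend k n (p : 'I_k.+1) (g h : word k.+1 n) :
  g p = h p -> g \oi skip p = h \oi skip p -> g = h.
Proof.
move=> gh E; apply: inj_ext => i; case: (unliftP p i) => [j ->|-> //].
by rewrite -skipE -!inj_compE E.
Qed.

Lemma extend_skip k n (p : 'I_k.+1) (y : 'I_n.+1) (w : word k n) :
  extend p y w \oi skip p = skip y \oi w.
Proof. by apply: inj_ext => i; rewrite !inj_compE !skipE extend_lift. Qed.

Lemma extend_comp k n m (p : 'I_k.+1) (q : 'I_n.+1) (z : 'I_m.+1)
    (v : word n m) (w : word k n) :
  extend q z v \oi extend p q w = extend p z (v \oi w).
Proof.
apply: (@eq_extend _ _ p); first by rewrite inj_compE !extend_at.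
by rewrite -inj_compA !extend_skip inj_compA extend_skip inj_compA.
Qed.

Lemma skip_factor k n (y : 'I_n.+1) (w : word k n.+1) :
  (forall i, w i != y) -> exists v, w = skip y \oi v.
Proof.
move=> wy; have wy' i : y != w i by rewrite eq_sym.
have vi : injectiveb [ffun i => s2val (unlift_some (wy' i))].
  apply/injectiveP => i j; rewrite !ffunE.
  case: (unlift_some (wy' i)) => /= a ea _; case: (unlift_some (wy' j)) => /= b eb _ ab.
  by apply: (@inj_injective _ _ w); rewrite ea eb ab.
exists (Inj vi); apply: inj_ext => i; rewrite inj_compE skipE !ffunE /=.
by case: (unlift_some (wy' i)).
Qed.

Fact face_subproof k n (p : 'I_k.+1) (w : word k.+1 n.+1) :
  exists v, w \oi skip p = skip (w p) \oi v.
Proof.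
apply: skip_factor => i; rewrite inj_compE skipE.
by apply/eqP => /inj_injective/eqP; rewrite eq_sym (negPf (neq_lift _ _)).
Qed.

(* Deletes position [p], and renumbers the letters other than [w p]. *)
Definition face k n (p : 'I_k.+1) (w : word k.+1 n.+1) : word k n :=
  projT1 (cid (face_subproof p w)).

Lemma faceP k n (p : 'I_k.+1) (w : word k.+1 n.+1) : w \oi skip p = skip (w p) \oi face p w.
Proof. exact: projT2 (cid (face_subproof p w)). Qed.

Lemma face_unique k n (p : 'I_k.+1) (w : word k.+1 n.+1) v :
  w \oi skip p = skip (w p) \oi v -> face p w = v.
Proof. by rewrite faceP => /inj_comp_inj. Qed.

Lemma face_lift k n (p : 'I_k.+1) (w : word k.+1 n.+1) i :
  w (lift p i) = lift (w p) (face p w i).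
Proof. by rewrite -!skipE -!inj_compE faceP. Qed.

Lemma extend_face k n (p : 'I_k.+1) (w : word k.+1 n.+1) : extend p (w p) (face p w) = w.
Proof.
by apply: (@eq_extend _ _ p); rewrite ?extend_at // extend_skip faceP.
Qed.

Lemma face_extend k n (p : 'I_k.+1) (y : 'I_n.+1) (w : word k n) :
  face p (extend p y w) = w.
Proof. by apply: face_unique; rewrite extend_skip extend_at. Qed.

(** A word that is not a permutation misses a letter and so factors through a [skip]. Naturality in
    all words thus reduces to permutations and single deletions. *)
Lemma word_gen (Q : forall k n, word k n -> Prop) :
    (forall k (s : word k k), Q k k s) ->
    (forall k (p : 'I_k.+1), Q _ _ (skip p)) ->
    (forall k n m (f : word k n) (g : word n m), Q _ _ f -> Q _ _ g -> Q _ _ (g \oi f)) ->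
  forall k n (f : word k n), Q k n f.
Proof.
move=> Qs Qd Qc k n; elim: n k => [|n IHn] k f.
  by have := word_leq f; rewrite leqn0 => /eqP k0; subst k; apply: Qs.
have := word_leq f; rewrite leq_eqVlt => /predU1P[kn|kn]; first by subst k; apply: Qs.
have [p pf] : exists p, p \notin codom f.
  apply/existsP; rewrite -negb_forall; apply/negP => /forallP H.
  have : (#|'I_n.+1| <= #|codom f|)%N by apply/subset_leq_card/fintype.subsetP => x _.
  by rewrite card_codom; [rewrite !card_ord leqNgt kn | exact: inj_injective].
have fp i : f i != p by apply: contraNneq pf => <-; apply: codom_f.
have [v ->] := skip_factor fp.
exact: Qc.
Qed.

End Injections.

(** * Free modules on words *)

Section FreeModules.
Variable R : comPzRingType.

Definition freemod (T : finType) : lmodType R := {ffun T -> R^o}.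

Definition delta (T : finType) (x : T) : freemod T := [ffun y => (x == y)%:R].

Definition lin_fun (T : finType) (V : lmodType R) (F : T -> V) (v : freemod T) : V :=
  \sum_x (v x : R) *: F x.

Fact lin_is_linear (T : finType) (V : lmodType R) (F : T -> V) : linear (lin_fun F).
Proof.
move=> a u v; rewrite /lin_fun scaler_sumr -big_split /=; apply: eq_bigr => x _.
by rewrite !ffunE scalerDl scalerA.
Qed.
HB.instance Definition _ T (V : lmodType R) F :=
  GRing.isLinear.Build R (freemod T) V _ (lin_fun F) (@lin_is_linear T V F).

Definition lin (T : finType) (V : lmodType R) (F : T -> V) : {linear freemod T -> V} := lin_fun F.

Arguments lin {T V} F : simpl never.

Lemma freemod_delta (T : finType) (v : freemod T) : v = \sum_x (v x : R) *: delta x.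
Proof.
apply/ffunP => y; rewrite sum_ffunE (bigD1 y) //= !ffunE eqxx big1 ?addr0 => [|x xy].
  by rewrite /GRing.scale /= mulr1.
by rewrite !ffunE (negPf xy) scaler0.
Qed.

Lemma linE (T : finType) (V : lmodType R) (F : T -> V) v :
  lin F v = \sum_x (v x : R) *: F x.
Proof. by []. Qed.

Lemma lin_delta (T : finType) (V : lmodType R) (F : T -> V) x : lin F (delta x) = F x.
Proof.
rewrite linE (bigD1 x) //= big1 => [|y yx]; first by rewrite ffunE eqxx scale1r addr0.
by rewrite ffunE eq_sym (negPf yx) scale0r.
Qed.

Lemma freemod_ext (T : finType) (V : lmodType R) (f g : {linear freemod T -> V}) :
  (forall x, f (delta x) = g (delta x)) -> f =1 g.
Proof.
move=> fg v; rewrite (freemod_delta v) !linear_sum; apply: eq_bigr => x _.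
by rewrite !linearZ_LR fg.
Qed.

Definition pull (S T U : finType) (f : inj S T) : {linear freemod (inj T U) -> freemod (inj S U)} :=
  lin (fun g => delta (g \oi f)).

Arguments pull {S T U} f : simpl never.

Definition push (S T U : finType) (g : inj T U) : {linear freemod (inj S T) -> freemod (inj S U)} :=
  lin (fun f => delta (g \oi f)).

Arguments push {S T U} g : simpl never.

Lemma pull_delta (S T U : finType) (f : inj S T) (g : inj T U) :
  pull f (delta g) = delta (g \oi f).
Proof. exact: lin_delta. Qed.

Lemma push_delta (S T U : finType) (g : inj T U) (f : inj S T) :
  push g (delta f) = delta (g \oi f).
Proof. exact: lin_delta. Qed.

Lemma pull_comp (S T U V : finType) (f : inj S T) (g : inj T U) (v : freemod (inj U V)) :
  pull (g \oi f) v = pull f (pull g v).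
Proof.
apply: (@freemod_ext _ _ (pull (g \oi f)) (pull f \o pull g)) => h /=.
by rewrite !pull_delta inj_compA.
Qed.

Lemma pull_id (S T : finType) (v : freemod (inj S T)) : pull (inj_id S) v = v.
Proof.
apply: (@freemod_ext _ _ (pull (inj_id S)) idfun) => h /=.
by rewrite !pull_delta inj_comp_id.
Qed.

(** The map of right modules over the group algebra of the permutations of [S] that sends the
    identity to [G]. *)
Definition dot (S T : finType) (G : freemod (inj S T)) :
    {linear freemod (inj S S) -> freemod (inj S T)} :=
  lin (fun s => pull s G).

Arguments dot {S T} G : simpl never.

Lemma dot_delta (S T : finType) (G : freemod (inj S T)) s : dot G (delta s) = pull s G.
Proof. exact: lin_delta. Qed.

Lemma dotE (S T : finType) (G : freemod (inj S T)) c :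
  dot G c = \sum_s (c s : R) *: pull s G.
Proof. by []. Qed.

Lemma dot0 (S T : finType) (c : freemod (inj S S)) : dot (0 : freemod (inj S T)) c = 0.
Proof. by rewrite /dot linE big1 // => s _; rewrite linear0 scaler0. Qed.

Lemma dot_id (S : finType) (c : freemod (inj S S)) : dot (delta (inj_id S)) c = c.
Proof.
apply: (@freemod_ext _ _ (dot _) idfun) => s /=.
by rewrite dot_delta pull_delta inj_id_comp.
Qed.

Lemma dot_pull (S T : finType) (G : freemod (inj S T)) (s : inj S S) c :
  pull s (dot G c) = dot G (pull s c).
Proof.
apply: (@freemod_ext _ _ (pull s \o dot G) (dot G \o pull s)) => t /=.
by rewrite pull_delta !dot_delta pull_comp.
Qed.

Lemma dot_comm (S T U : finType) (G : freemod (inj S T)) c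
    (f : {linear freemod (inj S T) -> freemod (inj S U)}) :
    (forall s v, f (pull s v) = pull s (f v)) ->
  f (dot G c) = dot (f G) c.
Proof.
move=> fs; rewrite /dot !linE linear_sum; apply: eq_bigr => s _.
by rewrite linearZ_LR fs.
Qed.

(* The face maps of the right module whose degree-[k] part is free on the
   words of length [k] in [k] letters, where deleting one of the [l] smallest
   letters gives [0]. *)
Definition bface l k (p : 'I_k.+1) : {linear freemod (word k.+1 k.+1) -> freemod (word k k)} :=
  lin (fun s : word k.+1 k.+1 => if (s p < l)%N then 0 else delta (face p s)).

Arguments bface l {k} p : simpl never.

Lemma bface_delta l k (p : 'I_k.+1) s :
  bface l p (delta s) = if (s p < l)%N then 0 else delta (face p s).
Proof. exact: lin_delta. Qed.

Lemma bface_small l k (p : 'I_k.+1) v : (k < l)%N -> bface l p v = 0.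
Proof.
move=> kl; apply: (@freemod_ext _ _ (bface l p) \0) => s /=.
by rewrite bface_delta ifT // (leq_trans _ kl) // ltn_ord.
Qed.

(** The hypothesis says that [G'] and [G] behave like the identity permutations in [B_l]. Since
    [s \oi skip p = skip (s p) \oi face p s], this one relation makes [dot] commute with every
    deletion. *)
Lemma dot_bface l k n (G' : freemod (word k.+1 n)) (G : freemod (word k n)) p c :
    (forall i, pull (skip i) G' = if (i < l)%N then 0 else G) ->
  pull (skip p) (dot G' c) = dot G (bface l p c).
Proof.
move=> HG; apply: (@freemod_ext _ _ (pull (skip p) \o dot G') (dot G \o bface l p)) => s /=.
rewrite dot_delta -pull_comp faceP pull_comp HG bface_delta.
by case: ifP => _; rewrite ?linear0 // dot_delta.
Qed.

Lemma lift_lift k (i j : 'I_k.+2) (i' j' : 'I_k.+1) :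
  i = lift j i' -> j = lift i j' -> skip j \oi skip i' = skip i \oi skip j'.
Proof.
move=> ei ej; apply: inj_ext => x; rewrite !inj_compE !skipE; apply: val_inj => /=.
move: (congr1 val ei) (congr1 val ej) => /=; rewrite /bump; lia.
Qed.

Lemma lift_exchange k (i j : 'I_k.+1) :
  i != j -> exists (i' j' : 'I_k), i = lift j i' /\ j = lift i j'.
Proof.
move=> ij; have ji : j != i by rewrite eq_sym.
have [i' ei _] := unlift_some ji; have [j' ej _] := unlift_some ij.
by exists i', j'.
Qed.
End FreeModules.

Arguments delta {R T} x.
Arguments lin {R T V} F : simpl never.
Arguments pull {R S T U} f : simpl never.
Arguments push {R S T U} g : simpl never.
Arguments dot {R S T} G : simpl never.
Arguments bface {R} l {k} p : simpl never.

(** * Filling compatible families *)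

Section Filling.
Variable R : comPzRingType.

(** Deleting a letter that is at least [l] does not change which other letters are below [l]. So
    both sides vanish on the same permutations, and otherwise delete the same two positions. *)
Lemma bface_bface l k (i j : 'I_k.+2) (i' j' : 'I_k.+1) (c : freemod R (word k.+2 k.+2)) :
    i = lift j i' -> j = lift i j' ->
  bface l i' (bface l j c) = bface l j' (bface l i c).
Proof.
move=> ei ej; have E := lift_lift ei ej.
apply: (@freemod_ext _ _ _ (bface l i' \o bface l j) (bface l j' \o bface l i)) => s /=.
have si : s i = lift (s j) (face j s i') by rewrite ei face_lift.
have sj : s j = lift (s i) (face i s j') by rewrite {1}ej face_lift.
have -> : bface l i' (bface l j (delta s)) =
    if (s i < l)%N || (s j < l)%N then 0 else delta (face i' (face j s)) :> freemod R _.
  rewrite bface_delta orbC; case: ifP => sjl /=; first by rewrite linear0.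
  rewrite bface_delta; suff -> : (face j s i' < l)%N = (s i < l)%N by [].
  by move: sjl; rewrite si /= /bump; lia.
have -> : bface l j' (bface l i (delta s)) =
    if (s i < l)%N || (s j < l)%N then 0 else delta (face j' (face i s)) :> freemod R _.
  rewrite bface_delta; case: ifP => sil; first by rewrite linear0.
  rewrite bface_delta; suff -> : (face i s j' < l)%N = (s j < l)%N by [].
  by move: sil; rewrite sj /= /bump; lia.
congr (if _ then _ else delta _).
apply: face_unique; apply: (@inj_comp_inj _ _ _ (skip (s j))).
have -> : skip (s j) \oi (face j s \oi skip i') = skip (s i) \oi (face i s \oi skip j').
  by rewrite !inj_compA -!faceP -!inj_compA E.
by rewrite faceP !inj_compA (lift_lift si sj).
Qed.

(** Plays the role of an extra degeneracy: a section of the deletion at [j] when [l <= k], commuting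
    with the deletions elsewhere because a largest letter does not shift the others. *)
Definition append k (j : 'I_k.+1) : {linear freemod R (word k k) -> freemod R (word k.+1 k.+1)} :=
  lin (fun s => delta (extend j ord_max s)).

Arguments append {k} j : simpl never.

Lemma append_delta k (j : 'I_k.+1) s : append j (delta s) = delta (extend j ord_max s).
Proof. exact: lin_delta. Qed.

Lemma bface_append l k (j : 'I_k.+1) v : (l <= k)%N -> bface l j (append j v) = v.
Proof.
move=> lk; apply: (@freemod_ext _ _ _ (bface l j \o append j) idfun) => s /=.
by rewrite append_delta bface_delta extend_at ltnNge lk /= face_extend.
Qed.

Lemma bface_append_lift l k (i j : 'I_k.+2) (i' j' : 'I_k.+1) v :
    i = lift j i' -> j = lift i j' ->
  bface l i (append j v) = append j' (bface l i' v).
Proof.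
move=> ei ej; have E := lift_lift ei ej.
apply: (@freemod_ext _ _ _ (bface l i \o append j) (append j' \o bface l i')) => s /=.
have si : extend j ord_max s i = lift ord_max (s i') by rewrite ei extend_lift.
have m : ord_max = lift (lift ord_max (s i')) ord_max :> 'I_k.+2.
  apply: val_inj; case: (s i') => a ak /=; rewrite /bump; lia.
rewrite append_delta !bface_delta si.
have -> : (lift ord_max (s i') < l)%N = (s i' < l)%N.
  by case: (s i') => a ak /=; rewrite /bump; lia.
case: ifP => _; rewrite ?linear0 // append_delta; congr delta.
apply: face_unique; rewrite si; apply: (@eq_extend _ _ j').
  by rewrite inj_compE skipE -ej inj_compE !extend_at skipE -m.
rewrite -!inj_compA extend_skip -E !inj_compA extend_skip -[in LHS]inj_compA (faceP i' s).
by rewrite !inj_compA (lift_lift (erefl _) m).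
Qed.

(** As in filling horns of a simplicial group, the faces are corrected from left to right: the
    defect at position [m] is appended there, and compatibility makes its contribution to the
    earlier faces vanish. *)
Lemma bface_fill l k (b : 'I_k.+2 -> freemod R (word k.+1 k.+1)) :
    ((k.+1 < l)%N -> forall i, b i = 0) ->
    (forall (i j : 'I_k.+2) (i' j' : 'I_k.+1), i = lift j i' -> j = lift i j' ->
      bface l i' (b j) = bface l j' (b i)) ->
  exists c, forall i, bface l i c = b i.
Proof.
move=> b0 bb; have [kl|lk] := ltnP k.+1 l.
  by exists 0 => i; rewrite linear0 b0.
suff H m : exists c, forall i : 'I_k.+2, (i < m)%N -> bface l i c = b i.
  by have [c cb] := H k.+2; exists c => i; apply: cb.
elim: m => [|m [c IH]]; first by exists 0.
have [mk|km] := ltnP m k.+2; last first.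
  by exists c => i im; apply: IH; apply: leq_trans (ltn_ord i) km.
pose j := Ordinal mk.
exists (c + append j (b j - bface l j c)) => i; rewrite ltnS leq_eqVlt => /predU1P[ij|im].
  have -> : i = j by apply: val_inj.
  by rewrite linearD bface_append // addrC subrK.
have ij : i != j by rewrite -val_eqE /= ltn_eqF.
have [i' [j' [ei ej]]] := lift_exchange ij.
rewrite linearD (bface_append_lift _ _ ei ej) linearB (bface_bface _ _ ei ej) IH //.
by rewrite (bb _ _ _ _ ei ej) subrr linear0 addr0.
Qed.

End Filling.
Arguments append {R k} j : simpl never.

(** * Standardization *)

Section Standardization.

Lemma word_rank k n (w : word k n) i :
    (forall y : 'I_n, (y < w i)%N -> exists j, w j = y) ->
  #|[pred j | (w j < w i)%N]| = w i.
Proof.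
move=> wi; rewrite -[RHS]card_ord.
have f_lt (y : 'I_(w i)) : (y < n)%N by apply: ltn_trans (ltn_ord y) (ltn_ord _).
rewrite -(card_imset _ (@inj_injective _ _ w)).
have finj : injective (fun y => Ordinal (f_lt y)).
  by move=> y z [] /val_inj.
rewrite -(card_imset _ finj); apply: eq_card => y.
apply/imsetP/imsetP => [[j jw ->]|[z _ ->]].
  by exists (Ordinal (jw : (w j < w i)%N)) => //; apply: val_inj.
have [j jz] := wi (Ordinal (f_lt z)) (ltn_ord z).
by exists j; rewrite ?inE jz /=.
Qed.

Fact std_lt k n (w : word k n) i : (#|[pred j | (w j < w i)%N]| < k)%N.
Proof.
rewrite -[X in (_ < X)%N]card_ord; apply/proper_card/fintype.properP; split.
  exact/fintype.subsetP.
by exists i; rewrite // inE ltnn.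
Qed.

Lemma std_ltE k n (w : word k n) i j :
  (#|[pred a | (w a < w i)%N]| < #|[pred a | (w a < w j)%N]|)%N = (w i < w j)%N.
Proof.
have mono a b : (w a <= w b)%N ->
    (#|[pred c | (w c < w a)%N]| <= #|[pred c | (w c < w b)%N]|)%N.
  by move=> ab; apply/subset_leq_card/fintype.subsetP => c; rewrite !inE => /leq_trans; apply.
apply/idP/idP => [|wij]; first by apply: contraTT; rewrite -!leqNgt; apply: mono.
apply/proper_card/fintype.properP; split.
  by apply/fintype.subsetP => c; rewrite !inE => /ltn_trans; apply.
by exists i; rewrite !inE ?ltnn.
Qed.

Fact std_subproof k n (w : word k n) : injectiveb [ffun i => Ordinal (std_lt w i)].
Proof.
apply/injectiveP => i j; rewrite !ffunE => -[E].
apply: (@inj_injective _ _ w); apply: val_inj => /=; have := std_ltE w i j.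
by have := std_ltE w j i; rewrite E ltnn; case: ltngtP.
Qed.
Definition std k n (w : word k n) : word k k := Inj (std_subproof w).

Lemma std_val k n (w : word k n) i : std w i = #|[pred j | (w j < w i)%N]| :> nat.
Proof. by rewrite ffunE. Qed.

Lemma ltn_std k n (w : word k n) i j : (std w i < std w j)%N = (w i < w j)%N.
Proof. by rewrite !std_val std_ltE. Qed.

Lemma eq_std k n m (v : word k n) (w : word k m) :
  (forall i j, (v i < v j)%N = (w i < w j)%N) -> std v = std w.
Proof.
move=> vw; apply: inj_ext => i; apply: val_inj; rewrite /= !std_val.
by apply: eq_card => j; rewrite !inE vw.
Qed.

Lemma std_perm k (s : word k k) : std s = s.
Proof.
apply: inj_ext => i; apply: val_inj; rewrite /= std_val word_rank // => y _.
have [t [st _]] := word_inv s; exists (t y).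
by rewrite -inj_compE st inj_idE.
Qed.

Lemma std_comp k n (w : word k n) (s : word k k) : std (w \oi s) = std w \oi s.
Proof.
by rewrite -[RHS]std_perm; apply: eq_std => i j; rewrite !inj_compE ltn_std.
Qed.

Lemma std_mono k n m (g : word n m) (w : word k n) :
  {mono g : x y / (x < y)%N} -> std (g \oi w) = std w.
Proof. by move=> gm; apply: eq_std => i j; rewrite !inj_compE gm. Qed.

Lemma skip_mono k (p : 'I_k.+1) : {mono skip p : x y / (x < y)%N}.
Proof. by move=> x y; rewrite !skipE /= /bump; lia. Qed.

Fact widen_subproof k n (kn : (k <= n)%N) : injectiveb [ffun i : 'I_k => widen_ord kn i].
Proof. by apply/injectiveP => i j; rewrite !ffunE => -[] /val_inj. Qed.
Definition widen_word k n (kn : (k <= n)%N) : word k n := Inj (widen_subproof kn).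

Lemma widen_wordE k n (kn : (k <= n)%N) i : widen_word kn i = i :> nat.
Proof. by rewrite ffunE. Qed.

Lemma std_widen k n (kn : (k <= n)%N) (s : word k k) : std (widen_word kn \oi s) = s.
Proof.
by rewrite std_mono ?std_perm // => x y; rewrite !widen_wordE.
Qed.

End Standardization.

(** * Counting non-crossing sets of pairs *)

Section Counting.

(* A list [x :: t] stands for a non-crossing set of pairs in [n] letters: an
   adjacent pair [x, x + 1], and the set given by [t] in the other letters.  It
   is in normal form when the pairs are removed from left to right, and then
   corresponds to a ballot sequence; [y] bounds the first entry from below. *)
Fixpoint norm n y (t : seq nat) {struct t} : bool :=
  if t is x :: t' then
    if n is n'.+2 then [&& y <= x, x <= n' & norm n' x.-1 t']%N else false
  else true.

Fixpoint norms l n y {struct l} : seq (seq nat) :=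
  if l is l'.+1 then
    if n is n'.+2 then
      flatten [seq [seq x :: t | t <- norms l' n' x.-1] | x <- iota y (n'.+1 - y)]
    else [::]
  else [:: [::]].

Lemma mem_norms l n y t : (t \in norms l n y) = (size t == l) && norm n y t.
Proof.
elim: l n y t => [|l IHl] n y [|x t] //.
  by case: n => [|[|n]] //=; apply/flatten_mapP => -[x _ /mapP[]].
case: n => [|[|n]]; rewrite /= ?andbF // eqSS.
apply/flatten_mapP/and4P => [[x' + /mapP[t' + [-> ->]]]|[/eqP st yx xn nt]].
  by rewrite mem_iota IHl => xy /andP[-> ->]; split=> //; lia.
by exists x; [rewrite mem_iota; lia | rewrite map_f // IHl st eqxx].
Qed.

Lemma size_norms_rec l n y : (y <= n)%N ->
  size (norms l.+1 n.+2 y) = (size (norms l n y.-1) + size (norms l.+1 n.+2 y.+1))%N.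
Proof. by move=> yn; rewrite /= subSn //= size_cat size_map subSS. Qed.

Lemma size_norms_top l n : size (norms l.+1 n.+2 n.+1) = 0%N.
Proof. by rewrite /= subnn. Qed.

Arguments norms : simpl never.

(* The reflection principle: [y + 1] initial up-steps followed by a path of
   length [n - y - 1] with [l + 1] down-steps staying nonnegative. *)
Lemma size_norms_head l n y : (l.*2 < n)%N -> (y < n)%N ->
  (size (norms l.+1 n y) + (if y < l then 'C(n - y.+1, l - y.+1) else 0) = 'C(n - y.+1, l.+1))%N.
Proof.
elim: l n y => [|l IHl] n y ln yn.
  case: n ln yn => [|[|n]] ln yn; [by lia | by move: y yn => [|?] | ].
  rewrite ltn0 addn0 bin1; move: yn; rewrite ltnS => yn.
  (* Descending induction on [y] through [m = n + 1 - y], starting at [y = n + 1], where no list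
     exists. The case of larger [l] below runs in the same way. *)
  have [m ->] : exists m, y = (n.+1 - m)%N by exists (n.+1 - y)%N; lia.
  elim: m => [|m IHm]; first by rewrite subn0 size_norms_top subnn.
  have [mn|nm] := ltnP m n.+1; last first.
    by rewrite (_ : n.+1 - m.+1 = n.+1 - m)%N //; lia.
  rewrite size_norms_rec -?[size (norms 0 _ _)]/1%N; last by lia.
  by rewrite (_ : (n.+1 - m.+1).+1 = n.+1 - m)%N ?IHm; lia.
case: n ln yn => [|[|n]] ln yn; [by lia..|have {}ln : (l.*2 < n)%N by lia].
move: yn; rewrite ltnS => yn.
have [m mn ->] : exists2 m, (m <= n.+1)%N & y = (n.+1 - m)%N.
  by exists (n.+1 - y)%N; lia.
elim: m mn => [|m IHm] mn.
  by rewrite subn0 size_norms_top subnn bin0n /= ifF //; lia.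
have {IHm} := IHm (ltnW mn); set y' := (n.+1 - m.+1)%N.
have -> : (n.+1 - m = y'.+1)%N by rewrite /y'; lia.
have y'n : (y' <= n)%N by rewrite /y'; lia.
clearbody y' => {m mn y yn} E; rewrite size_norms_rec //.
(* The tails of lists with first entry [y'] are counted by the induction on [l]. Their bound [y'.-1]
   is truncated at [y' = 0], hence the separate case. *)
have := IHl n y'.-1 ln; case: y' y'n E => [|y] yn /= E H.
  have {yn}H := H ltac:(lia); case: n ln H E => // n _.
  rewrite !subSS !subn0; case: l {IHl} => [|l] /=.
    by rewrite ?subSS ?subn0 !binS ?bin0 => H E; rewrite -/(norms _ _ _); lia.
  by rewrite ?subSS ?subn0 !binS => H E; lia.
have {}H := H yn; rewrite ltnS !subSS in E *.
have [m em] : exists m, n = (m + y.+1)%N by exists (n - y.+1)%N; lia.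
move: H E; rewrite em; have -> : (m + y.+1 - y = m.+1)%N by lia.
rewrite addnK.
rewrite [(y.+1 < l.+1)%N]ltnS; have [yl|ly] := ltnP y l; last first.
  by rewrite ifF ?binS; lia.
have [q el] : exists q, l = (q + y.+1)%N by exists (l - y.+1)%N; lia.
rewrite {IHl ln yl}el addnK; case: q => [|q].
  by rewrite ltnn !binS !bin0; lia.
rewrite ifT; last by lia.
by rewrite (_ : (q.+1 + y.+1 - y.+2 = q)%N) ?binS; lia.
Qed.

(** The case [y = 0] of the reflection count; Pascal's rule turns its binomials in [n - 1] into
    those in [n]. *)
Lemma size_norms l n : (l.*2 <= n.+1)%N -> size (norms l n 0) = binom_diff n l.
Proof.
rewrite /binom_diff; case: l => [|l] ln; first by rewrite bin0.
case: n ln => [|n] ln; first by lia.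
have := @size_norms_head l n.+1 0 ltac:(lia) isT; rewrite subSS subn0 binS.
by case: l ln => [|l] ln /=; rewrite ?subSS ?subn0 ?subn1 ?binS ?bin0 /=; lia.
Qed.

End Counting.

(** * Inserting a pair of adjacent letters *)

Section Pairs.
Variable R : comPzRingType.

Definition std_map k n : {linear freemod R (word k n) -> freemod R (word k k)} :=
  lin (fun w => delta (std w)).
Arguments std_map {k n} : simpl never.

Lemma std_map_delta k n (w : word k n) : std_map (delta w) = delta (std w).
Proof. exact: lin_delta. Qed.

Lemma std_map_pull k n (s : word k k) (v : freemod R (word k n)) :
  std_map (pull s v) = pull s (std_map v).
Proof.
apply: (@freemod_ext _ _ _ (std_map \o pull s) (pull s \o std_map)) => w /=.
by rewrite pull_delta !std_map_delta pull_delta std_comp.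
Qed.

(** Skipping [lo x] raises the letter [x] to [x + 1], skipping [hi x] keeps it; all other letters
    move in the same way under both and avoid the pair [x], [x + 1]. *)
Definition lo n (x : 'I_n.+1) : 'I_n.+2 := widen_ord (leqnSn _) x.
Definition hi n (x : 'I_n.+1) : 'I_n.+2 := lift ord0 x.

(* [ins p x] puts the difference of the letters [x + 1] and [x] at position [p]. *)
Definition ins k n (p : 'I_k.+1) (x : 'I_n.+1) :
    {linear freemod R (word k n) -> freemod R (word k.+1 n.+2)} :=
  lin (fun w => delta (skip (lo x) \oi extend p x w) - delta (skip (hi x) \oi extend p x w)).
Arguments ins {k n} p x : simpl never.

Lemma ins_delta k n (p : 'I_k.+1) (x : 'I_n.+1) (w : word k n) : ins p x (delta w) =
  delta (skip (lo x) \oi extend p x w) - delta (skip (hi x) \oi extend p x w).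
Proof. exact: lin_delta. Qed.

Lemma lo_hi n (x : 'I_n.+1) : skip (lo x) \oi skip x = skip (hi x) \oi skip x.
Proof.
by apply: lift_lift; apply: val_inj; rewrite /= /bump; lia.
Qed.

Lemma std_map_ins k n (p : 'I_k.+1) (x : 'I_n.+1) v : std_map (ins p x v) = 0.
Proof.
apply: (@freemod_ext _ _ _ (std_map \o ins p x) \0) => w /=.
by rewrite ins_delta linearB /= !std_map_delta !std_mono ?subrr //; apply: skip_mono.
Qed.

Lemma pull_ins_at k n (p : 'I_k.+1) (x : 'I_n.+1) v : pull (skip p) (ins p x v) = 0.
Proof.
apply: (@freemod_ext _ _ _ (pull (skip p) \o ins p x) \0) => w /=.
rewrite ins_delta linearB /= !pull_delta -!inj_compA extend_skip !inj_compA lo_hi.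
by rewrite subrr.
Qed.

Lemma pull_extend_ins k m n (q : 'I_m.+1) (p : 'I_k.+1) (x : 'I_n.+1) (f : word k m) v :
  pull (extend p q f) (ins q x v) = ins p x (pull f v).
Proof.
apply: (@freemod_ext _ _ _ (pull (extend p q f) \o ins q x) (ins p x \o pull f)) => w /=.
by rewrite ins_delta linearB /= !pull_delta ins_delta -!inj_compA extend_comp.
Qed.

Lemma skip_lift0 k (i : 'I_k.+1) : skip (lift ord0 i) = extend ord0 ord0 (skip i).
Proof.
apply: (@eq_extend _ _ ord0); first by rewrite skipE extend_at; apply: val_inj.
by rewrite extend_skip (@lift_lift _ ord0 (lift ord0 i) ord0 i) //; apply: val_inj.
Qed.

Lemma pull_ins_lift k n (i : 'I_k.+1) (x : 'I_n.+1) v :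
  pull (skip (lift ord0 i)) (ins ord0 x v) = ins ord0 x (pull (skip i) v).
Proof. by rewrite skip_lift0 pull_extend_ins. Qed.

(** The transposition of the first two positions. *)
Definition swap k : word k.+2 k.+2 := extend ord0 (lift ord0 ord0) (inj_id _).

(** Treats the four words in the expansion of [ins_ins] at once: the bounds let [a] and [b] each be
    either [lo] or [hi] of their pair. *)
Lemma swap_words k n (a : 'I_n.+4) (x : 'I_n.+3) (b : 'I_n.+2) (y : 'I_n.+1)
    (b' : 'I_n.+4) (y' : 'I_n.+3) (a' : 'I_n.+2) (x' : 'I_n.+1) (w : word k n) :
    x = x'.+2 :> nat -> y' = y :> nat -> (y <= x')%N ->
    a = a'.+2 :> nat -> b' = b :> nat -> (x' <= a' <= x'.+1)%N -> (y <= b <= y.+1)%N ->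
  skip a \oi extend ord0 x (skip b \oi extend ord0 y w) =
  skip b' \oi extend ord0 y' (skip a' \oi extend ord0 x' w) \oi swap k.
Proof.
move=> xx yy yx aa bb ax bY.
apply: (@eq_extend _ _ ord0).
  rewrite !inj_compE !extend_at extend_lift inj_compE !skipE extend_at.
  by apply: val_inj; rewrite /= /bump; lia.
rewrite -!inj_compA !extend_skip inj_comp_id.
apply: (@eq_extend _ _ ord0).
  rewrite !inj_compE !skipE.
  have -> : lift (lift ord0 ord0) ord0 = ord0 :> 'I_k.+2 by apply: val_inj.
  rewrite !extend_at.
  by apply: val_inj; rewrite /= /bump; lia.
have E : skip (lift ord0 ord0) \oi skip ord0 = skip ord0 \oi skip ord0 :> word k k.+2.
  by apply: lift_lift; apply: val_inj.
rewrite -!inj_compA E; apply: inj_ext => i; rewrite !(inj_compE, skipE, extend_lift).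
by apply: val_inj; case: (w i) => c cn; rewrite /= /bump; lia.
Qed.

(** The lower pair [y] shifts the upper pair [x'] by two letters. Inserting the two pairs in the
    other order only exchanges the positions they occupy. *)
Lemma ins_ins k n (x y' : 'I_n.+3) (y x' : 'I_n.+1) (v : freemod R (word k n)) :
    x = x'.+2 :> nat -> y' = y :> nat -> (y <= x')%N ->
  ins ord0 x (ins ord0 y v) = pull (swap k) (ins ord0 y' (ins ord0 x' v)).
Proof.
move=> xx yy yx.
apply: (@freemod_ext _ _ _ (ins ord0 x \o ins ord0 y)
  (pull (swap k) \o ins ord0 y' \o ins ord0 x')) => w /=.
rewrite !ins_delta !linearB /= !ins_delta !linearB /= !pull_delta.
have W a b b' a' := @swap_words _ _ a x b y b' y' a' x' w xx yy yx.
rewrite -(W (lo x) (lo y) (lo y') (lo x')) -?(W (lo x) (hi y) (hi y') (lo x'))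
  -?(W (hi x) (lo y) (lo y') (hi x')) -?(W (hi x) (hi y) (hi y') (hi x'));
  try by rewrite /= /bump; lia.
exact: addrACA.
Qed.

End Pairs.
Arguments std_map {R k n} : simpl never.
Arguments ins {R k n} p x : simpl never.

(** * Generators attached to lists of pairs, and their normal forms *)

Section Generators.
Variable R : comPzRingType.

(** Lowering a letter [y + 1] to an absent letter [y] changes the word by a single [ins] term and
    decreases the sum of the letters, which is the induction measure. *)
Lemma diff_std_ind k n (kn : (k.+1 <= n.+2)%N) (Q : freemod R (word k.+1 n.+2) -> Prop) :
    Q 0 -> (forall u v, Q u -> Q v -> Q (u + v)) ->
    (forall p x (w : word k n), Q (ins p x (delta w))) ->
  forall w, Q (delta w - delta (widen_word kn \oi std w)).
Proof.
move=> Q0 QD Qins w; have [m] := ubnP (\sum_i w i); elim: m w => // m IHm w wm.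
case: (pselect (exists i y, w i = hi y /\ forall j, w j != lo y)) => [[i [y [wi wy]]]|H].
  have [w1 ew] := skip_factor wy.
  have w1i : w1 i = y.
    apply: (@lift_inj _ (lo y)); rewrite -skipE -inj_compE -ew wi.
    by apply: val_inj; rewrite /= /bump; lia.
  have ew1 := extend_face i w1; rewrite w1i in ew1.
  pose w' := skip (hi y) \oi w1.
  have sw : std w' = std w by rewrite ew /w' !std_mono //; apply: skip_mono.
  have lew j : (w' j <= w j)%N.
    by rewrite ew /w' !inj_compE !skipE; case: (w1 j) => c cn; rewrite /= /bump; lia.
  have ltw : (w' i < w i)%N.
    by rewrite ew /w' !inj_compE !skipE w1i /= /bump; lia.
  have -> : delta w - delta (widen_word kn \oi std w) =
      ins i y (delta (face i w1)) + (delta w' - delta (widen_word kn \oi std w')) :> freemod R _.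
    by rewrite ins_delta ew1 -ew sw addrA subrK.
  apply: QD; first exact: Qins.
  rewrite ltnS in wm; apply: IHm; apply: leq_trans wm; rewrite (bigD1 i) //= [leqRHS](bigD1 i) //=.
  by rewrite -addSn leq_add // leq_sum.
(* No letter can be lowered any more, so the occurring letters are closed downwards and each of them
   equals its rank. *)
have wH i y : w i = hi y -> exists j, w j = lo y.
  move=> wi; case: (pselect (exists j, w j = lo y)) => // E; case: H; exists i, y.
  by split=> // j; apply/eqP => wj; apply: E; exists j.
suff -> : widen_word kn \oi std w = w by rewrite subrr.
apply: inj_ext => i; apply: val_inj; rewrite inj_compE /= widen_wordE std_val.
apply: word_rank => y; have [d] := ubnP (w i - y); elim: d y => // d IHd y yd yw.
have yn : (y < n.+1)%N by have := ltn_ord (w i); lia.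
pose z : 'I_n.+1 := Ordinal yn.
have [j jz] : exists j, w j = hi z.
  have [e|ne] := eqVneq (w i : nat) y.+1.
    by exists i; apply: val_inj; rewrite /= e.
  have yz : hi z = y.+1 :> nat by [].
  by apply: IHd; rewrite yz; [lia | rewrite ltn_neqAle eq_sym ne].
have [j' jz'] := wH _ _ jz; exists j'; rewrite jz'; exact: val_inj.
Qed.

Variable u : forall n k, freemod R (word k n).

Fixpoint gen (t : seq nat) n k : freemod R (word k n) :=
  if t is x :: t' then
    match n, k with
    | n'.+2, k'.+1 => ins ord0 (inord x : 'I_n'.+1) (gen t' n' k')
    | _, _ => 0
    end
  else u n k.

Lemma gen_cons x t n k :
  gen (x :: t) n.+2 k.+1 = ins ord0 (inord x : 'I_n.+1) (gen t n k).
Proof. by []. Qed.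

Arguments gen : simpl never.

Lemma gen_small t n k : (k < size t)%N -> gen t n k = 0.
Proof.
by elim: t n k => // x t IHt [|[|n]] [|k] // kt; rewrite gen_cons IHt ?linear0.
Qed.

(* The normal form of [x :: t], following [ins_ins]. *)
Fixpoint insert x (t : seq nat) : seq nat :=
  if t is y :: t' then
    if (x <= y.+1)%N then x :: t else y :: insert (x - 2)%N t'
  else [:: x].

Lemma norm_insert n z b x t : norm n z t -> (x <= n)%N -> (b <= x)%N -> (b <= z)%N ->
  norm n.+2 b (insert x t).
Proof.
elim: t n z b x => [|y t IHt] n z b x /=; first by move=> _ -> ->.
case: n => [|[|n]] // /and3P[zy yn nt] xn bx bz; case: leqP => xy /=.
  by rewrite bx xn yn nt !andbT; lia.
by rewrite (IHt _ _ _ _ nt) ?andbT; lia.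
Qed.

Lemma size_insert x t : size (insert x t) = (size t).+1.
Proof. by elim: t x => [|y t IHt] x //=; case: ifP => //= _; rewrite IHt. Qed.

(** Every exchange made by [insert] is an instance of [ins_ins] and costs one permutation of the
    positions. *)
Lemma gen_insert n z x t k : norm n z t -> (x <= n)%N ->
  exists s, ins ord0 (inord x : 'I_n.+1) (gen t n k) = pull s (gen (insert x t) n.+2 k.+1).
Proof.
have id_case v : exists s : word k.+1 k.+1, v = pull s v :> freemod R (word k.+1 n.+2).
  by exists (inj_id _); rewrite pull_id.
elim: t n z x k id_case => [|y t IHt] n z x k id_case; first by move=> *; apply: id_case.
case: n id_case => [|[|n]] id_case // => /and3P[zy yn nt] xn.
rewrite -[insert x (y :: t)]/(if (x <= y.+1)%N then x :: y :: t else y :: insert (x - 2)%N t).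
case: leqP => xy; first exact: id_case.
case: k id_case => [|k] id_case.
  exists (inj_id _); rewrite linear0 gen_cons gen_small ?size_insert // linear0.
  by rewrite linear0.
have [||s es] := IHt n y.-1 (x - 2)%N k _ nt; [|by lia|].
  by move=> v; exists (inj_id _); rewrite pull_id.
exists (extend ord0 ord0 s \oi swap k).
have ex : (inord x : 'I_n.+3) = x :> nat by rewrite inordK.
have ex' : (inord (x - 2) : 'I_n.+1) = (x - 2)%N :> nat by rewrite inordK //; lia.
have ey : (inord y : 'I_n.+1) = y :> nat by rewrite inordK.
have ey' : (inord y : 'I_n.+3) = y :> nat by rewrite inordK //; lia.
rewrite gen_cons (@ins_ins _ _ _ _ (inord y) _ (inord (x - 2))).
- apply: etrans (congr1 (fun v => pull (swap k) (ins ord0 (inord y) v)) es) _.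
  apply: etrans (esym (pull_comp _ _ _)); congr (pull _ _).
  by rewrite gen_cons; apply: esym; apply: pull_extend_ins.
- by rewrite ex ex'; lia.
- by rewrite ey ey'.
- by rewrite ey ex'; lia.
Qed.

End Generators.
Arguments gen {R} u t n k : simpl never.

(** * Ranks, and injectivity of surjections between free modules *)

Section Rank.
Variable R : comPzRingType.

(** Preimages of the basis give a one-sided inverse of a square matrix, which over a commutative
    ring is two-sided. *)
Lemma surjective_freemod_inj (T U : finType) (f : {linear freemod R T -> freemod R U}) :
  #|T| = #|U| -> (forall v, exists c, f c = v) -> injective f.
Proof.
move=> TU fs.
have [g fg] := choice (fun y : U => fs (delta y)).
pose A : 'M[R]_(#|U|) := \matrix_(i, j) g (enum_val i) (enum_val (cast_ord (esym TU) j)).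
pose B : 'M[R]_(#|U|) := \matrix_(i, j) f (delta (enum_val (cast_ord (esym TU) i))) (enum_val j).
have AB : A *m B = 1%:M.
  apply/matrixP => i j; rewrite !mxE.
  transitivity (f (g (enum_val i)) (enum_val j)); last first.
    by rewrite fg ffunE (inj_eq enum_val_inj).
  rewrite [in RHS](freemod_delta (g (enum_val i))) linear_sum sum_ffunE.
  rewrite (reindex (fun j : 'I_#|U| => enum_val (cast_ord (esym TU) j))) /=; last first.
    exists (fun x => cast_ord TU (enum_rank x)) => x _.
      by rewrite enum_valK cast_ordKV.
    by rewrite cast_ordK enum_rankK.
  by apply: eq_bigr => l _; rewrite !mxE linearZ_LR !ffunE.
have {AB}BA := mulmx1C AB.
have gf x : lin g (f (delta x)) = delta x.
  apply/ffunP => x'.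
  have /matrixP/(_ (cast_ord TU (enum_rank x)) (cast_ord TU (enum_rank x'))) := BA.
  rewrite !mxE ffunE.
  rewrite (inj_eq (@cast_ord_inj _ _ _)) (inj_eq enum_rank_inj) => <-.
  rewrite linE sum_ffunE (reindex (@enum_val U U)) /=; last first.
    by exists enum_rank => y _; rewrite ?enum_valK ?enum_rankK.
  by apply: eq_bigr => l _; rewrite !mxE !ffunE !cast_ordK !enum_rankK.
apply: (@can_inj _ _ f (lin g)) => c.
exact: (@freemod_ext _ _ _ (lin g \o f) idfun gf).
Qed.

Lemma card_word k n : #|{: word k n}| = (n ^_ k)%N.
Proof.
rewrite -[X in (X ^_ _)%N]card_ord -[X in (_ ^_ X)%N]card_ord -card_inj_ffuns.
rewrite -(card_imset _ (@val_inj _ _ (inj 'I_k 'I_n))); apply: eq_card => f.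
apply/imsetP/idP => [[g _ ->]|fi]; first by rewrite inE; exact: injP.
by rewrite inE in fi; exists (Inj fi).
Qed.

(** The sum telescopes, as the subtractions are not truncated in this range. *)
Lemma sum_binom_diff n k : (k.*2 <= n.+1)%N -> (\sum_(l < k.+1) binom_diff n l = 'C(n, k))%N.
Proof.
elim: k => [|k IHk] kn; first by rewrite big_ord1 /binom_diff bin0.
rewrite big_ord_recr /= IHk; last by lia.
rewrite /binom_diff subnKC //; apply: (@leq_bin_succ k.+1) => //.
by lia.
Qed.

End Rank.

(** * Spanning and linear independence *)

Section Decomposition.
Variables (R : comPzRingType) (u : forall n k, freemod R (word k n)).

(** The deletion-invariant elements of the overview, up to degree [K]. The condition on [std_map]
    normalizes them: modulo differences of words with equal standardization, [u n k] is the
    increasing word. *)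
Definition admissible K : Prop :=
  (forall n k, (k < K)%N -> (k.+1.*2 <= n.+1)%N ->
    forall i, pull (skip i) (u n k.+1) = u n k) /\
  (forall n k, (k <= K)%N -> (k.*2 <= n.+1)%N -> std_map (u n k) = delta (inj_id _)).

Definition ngen n l i k := gen u (nth [::] (norms l n 0) i) n k.

(** Coefficients are indexed by all natural numbers, so that their type does not depend on [n] and
    [l]; only those in the range of the sums count. *)
Definition comb n k d (c : nat -> nat -> freemod R (word k k)) : freemod R (word k n) :=
  \sum_(l < d.+1) \sum_(i < binom_diff n l) dot (ngen n l i k) (c l i).

Lemma combD n k d (c c' : nat -> nat -> freemod R (word k k)) :
  comb n d (fun l i => c l i + c' l i) = comb n d c + comb n d c'.
Proof.
by rewrite -big_split; apply: eq_bigr => l _; rewrite -big_split; apply: eq_bigr => i _;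
  rewrite linearD.
Qed.

Lemma combB n k d (c c' : nat -> nat -> freemod R (word k k)) :
  comb n d (fun l i => c l i - c' l i) = comb n d c - comb n d c'.
Proof.
rewrite -sumrB; apply: eq_bigr => l _; rewrite -sumrB; apply: eq_bigr => i _.
by rewrite linearB.
Qed.

Lemma comb_pull n k d s c :
  pull s (comb n d c) = comb n d (fun l i => pull s (c l i)) :> freemod R (word k n).
Proof.
rewrite linear_sum; apply: eq_bigr => l _; rewrite linear_sum; apply: eq_bigr => i _.
exact: dot_pull.
Qed.

Lemma ngenP n l i k : (l <= k)%N -> (k.*2 <= n.+1)%N -> (i < binom_diff n l)%N ->
  size (nth [::] (norms l n 0) i) = l /\ norm n 0 (nth [::] (norms l n 0) i).
Proof.
move=> lk kn il; have : nth [::] (norms l n 0) i \in norms l n 0.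
  by rewrite mem_nth // size_norms //; lia.
by rewrite mem_norms => /andP[/eqP].
Qed.

Definition spanned n k (v : freemod R (word k n)) := exists c, v = comb n k c.

Lemma spanned0 n k : spanned (0 : freemod R (word k n)).
Proof.
exists (fun _ _ => 0); rewrite /comb big1 // => l _; rewrite big1 // => i _.
by rewrite linear0.
Qed.

Lemma spannedD n k (v w : freemod R (word k n)) : spanned v -> spanned w -> spanned (v + w).
Proof. by move=> [c ->] [c' ->]; eexists; rewrite -combD. Qed.

Lemma spanned_pull n k (s : word k k) (v : freemod R (word k n)) : spanned v -> spanned (pull s v).
Proof. by move=> [c ->]; eexists; rewrite comb_pull. Qed.

Lemma spanned_gen n k t c : (k.*2 <= n.+1)%N -> norm n 0 t -> spanned (dot (gen u t n k) c).
Proof.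
move=> kn nt; have [tk|kt] := leqP (size t) k; last first.
  by rewrite gen_small // dot0; apply: spanned0.
have tn : t \in norms (size t) n 0 by rewrite mem_norms eqxx.
exists (fun l i => if (l == size t) && (i == index t (norms (size t) n 0)) then c else 0).
have tk' : (size t < k.+1)%N by [].
rewrite /comb (bigD1 (Ordinal tk')) //= [X in _ = _ + X]big1 => [|l lt]; last first.
  by rewrite big1 // => i _; rewrite -val_eqE /= in lt; rewrite (negPf lt) linear0.
have ti : (index t (norms (size t) n 0) < binom_diff n (size t))%N.
  by rewrite -size_norms ?index_mem //; lia.
rewrite addr0 (bigD1 (Ordinal ti)) //= [X in _ = _ + X]big1 => [|i it]; last first.
  by rewrite -val_eqE /= in it; rewrite (negPf it) andbF linear0.
by rewrite !eqxx addr0 /ngen nth_index.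
Qed.

Lemma spanned_sum n k (I : finType) (v : I -> freemod R (word k n)) :
  (forall i, spanned (v i)) -> spanned (\sum_i v i).
Proof. by move=> H; apply: big_ind => //; [apply: spanned0 | apply: spannedD]. Qed.

Lemma spannedZ n k a (v : freemod R (word k n)) : spanned v -> spanned (a *: v).
Proof.
move=> [c ->]; exists (fun l i => a *: c l i).
rewrite scaler_sumr; apply: eq_bigr => l _; rewrite scaler_sumr; apply: eq_bigr => i _.
by rewrite linearZ_LR.
Qed.

Lemma spanned_lin n k (T : finType) (F : T -> freemod R (word k n)) v :
  (forall x, spanned (F x)) -> spanned (lin F v).
Proof. by move=> H; apply: spanned_sum => x; apply: spannedZ. Qed.

Variable K : nat.
Hypothesis uK : admissible K.

(** Modulo the given differences, an element is determined by its image under [std_map]. A word [w]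
    and [pull (std w) (u n k)] have the same image, and the latter is spanned by the generator of
    the empty list. *)
Lemma spanned_of_diff_std n k (kn : (k <= n)%N) (v : freemod R (word k n)) :
    (k <= K)%N -> (k.*2 <= n.+1)%N ->
    (forall w : word k n, spanned (delta w - delta (widen_word kn \oi std w))) ->
  spanned v.
Proof.
move=> kK kn' H.
have can_std e : spanned (e - push (widen_word kn) (std_map e)).
  have -> : e - push (widen_word kn) (std_map e) =
      lin (fun w => delta w - delta (widen_word kn \oi std w)) e.
    apply: (@freemod_ext _ _ _ (idfun \- (push (widen_word kn) \o std_map))) => w.
    by rewrite lin_delta -push_delta -std_map_delta.
  exact: spanned_lin.
have -> : v = lin delta v by rewrite linE -freemod_delta.
apply: spanned_lin => w.
have <- : delta w - pull (std w) (u n k) + pull (std w) (u n k) = delta w :> freemod R _.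
  by rewrite subrK.
apply: spannedD; last by rewrite -dot_delta; apply: (@spanned_gen _ _ [::]).
have := can_std (delta w - pull (std w) (u n k)); rewrite [std_map _]linearB.
by rewrite std_map_delta std_map_pull (proj2 uK) // pull_delta inj_id_comp subrr linear0 subr0.
Qed.

(** Differences reduce to words with a pair inserted; removing it lowers the degree by one and the
    number of letters by two, which preserves the bound [k.*2 <= n.+1]. *)
Lemma spanning n k (v : freemod R (word k n)) :
  (k <= K)%N -> (k.*2 <= n.+1)%N -> spanned v.
Proof.
elim: k n v => [|k IHk] n v kK kn.
  apply: (@spanned_of_diff_std _ _ (leq0n n)) => // w.
  suff -> : widen_word (leq0n n) \oi std w = w by rewrite subrr; apply: spanned0.
  by apply: inj_ext => -[].
have kn' : (k.+1 <= n)%N by lia.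
apply: (@spanned_of_diff_std _ _ kn') => // w {v}.
case: n kn kn' w => [|[|n]] kn kn' w; first by [].
  have k0 : k = 0%N by lia.
  subst k; suff -> : widen_word kn' \oi std w = w by rewrite subrr; apply: spanned0.
  by apply: inj_ext => i; rewrite !ord1.
apply: diff_std_ind => [||p x w']; [exact: spanned0 | exact: spannedD |].
(* A permutation of the positions moves the pair to the front. *)
have -> : ins p x (delta w') =
    pull (extend p ord0 (inj_id _)) (ins ord0 x (delta w')) :> freemod R _.
  by rewrite pull_extend_ins pull_id.
apply: spanned_pull; have [||c ->] := IHk n (delta w'); [lia|lia|].
rewrite linear_sum; apply: spanned_sum => l; rewrite linear_sum; apply: spanned_sum => i.
have k2 : (k.*2 <= n.+1)%N by lia.
have [_ nt] := ngenP (ltn_ord l : (l <= k)%N) k2 (ltn_ord i).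
rewrite /ngen; set t := nth _ _ _ in nt *.
rewrite dotE linear_sum; apply: spanned_sum => s; rewrite linearZ_LR; apply: spannedZ.
rewrite -(@pull_extend_ins _ _ _ _ ord0 ord0 x s); apply: spanned_pull.
have xn : (x <= n)%N by rewrite -ltnS.
have [s' es] := gen_insert u k nt xn; rewrite inord_val in es; rewrite es.
rewrite -dot_delta; apply: spanned_gen => //.
exact: (norm_insert nt xn).
Qed.

(** By [spanning] the map from coefficients is onto, and both sides are free of rank
    ['C(n, k) * k!]. *)
Lemma comb_inj n k c : (k <= K)%N -> (k.*2 <= n.+1)%N -> comb n k c = 0 ->
  forall l i, (l <= k)%N -> (i < binom_diff n l)%N -> c l i = 0 :> freemod R (word k k).
Proof.
move=> kK kn c0 l i lk il.
pose I := {l : 'I_k.+1 & 'I_(binom_diff n l)}.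
pose f : {linear freemod R (I * word k k)%type -> freemod R (word k n)} :=
  lin (fun x : I * word k k => pull x.2 (ngen n (tag x.1) (tagged x.1) k)).
have fE (b : nat -> nat -> freemod R (word k k)) :
    f [ffun x : I * word k k => b (tag x.1) (tagged x.1) x.2] = comb n k b.
  have -> : comb n k b = \sum_(x : I) \sum_s
      (b (tag x) (tagged x) s : R) *: pull s (ngen n (tag x) (tagged x) k).
    by rewrite /comb sig_big_dep; apply: eq_bigr => x _; apply: dotE.
  by rewrite pair_bigA linE; apply: eq_bigr => x _; rewrite ffunE.
have finj : injective f.
  apply: surjective_freemod_inj => [|v].
    rewrite card_prod card_tagged sumnE big_map big_enum /= card_word ffactnn.
    under eq_bigr do rewrite card_ord.
    by rewrite sum_binom_diff // bin_ffact card_word.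
  by have [b ->] := spanning v kK kn; eexists; apply: fE.
have /finj/ffunP E : f [ffun x : I * word k k => c (tag x.1) (tagged x.1) x.2] = f 0.
  by rewrite fE c0 linear0.
apply/ffunP => s; have lk' : (l < k.+1)%N by [].
pose li : I := Tagged _ (Ordinal il : 'I_(binom_diff n (Ordinal lk'))).
have := E (li, s).
by rewrite !ffunE.
Qed.

End Decomposition.

(** * Existence of deletion-invariant elements *)

Section Compatible.
Variable R : comPzRingType.

(** Deleting one of the first [size t] positions kills a pair; any other deletion reaches [u], which
    sits only in degree [k + 1 - size t], hence the weak bound on [k]. *)
Lemma gen_face (u : forall n k, freemod R (word k n)) K t n k (i : 'I_k.+1) :
    admissible u K -> (k < K + size t)%N -> (k.+1.*2 <= n.+1)%N ->
  pull (skip i) (gen u t n k.+1) = if (i < size t)%N then 0 else gen u t n k.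
Proof.
move=> uK; elim: t n k i => [|x t IHt] n k i; first by rewrite addn0 => kK kn; apply: (proj1 uK).
rewrite [size _]/= addnS ltnS => kK kn; case: n kn => [|[|n]] kn.
- by have -> m : gen u (x :: t) 0 m = 0 by []; rewrite linear0 if_same.
- by have -> m : gen u (x :: t) 1 m = 0 by []; rewrite linear0 if_same.
rewrite gen_cons; case: (unliftP ord0 i) => [i' ->|->]; last first.
  by rewrite pull_ins_at.
case: k i i' kK kn => [|k] i i' kK kn; first by case: i'.
rewrite pull_ins_lift IHt ?gen_cons; [|lia|lia].
by case: ifP => it; rewrite ?linear0; case: ifP => // jt; move: it jt; rewrite /= /bump; lia.
Qed.

(** Each summand is handled by [dot_bface]; the one with [l = k + 1] disappears because [B_l] is
    zero in degree [k]. *)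
Lemma comb_face (u : forall n k, freemod R (word k n)) K n k (p : 'I_k.+1) c :
    admissible u K -> (k.+1.*2 <= n.+1)%N ->
    (forall l i, c l i = 0 \/ (k < K + l)%N) ->
  pull (skip p) (comb u n k.+1 c) = comb u n k (fun l i => bface l p (c l i)).
Proof.
move=> uK kn cK; rewrite /comb [X in pull _ X]big_ord_recr linearD [X in _ + X]linear_sum.
rewrite [X in _ + X]big1 ?addr0 => [|i _].
  rewrite linear_sum; apply: eq_bigr => l _; rewrite linear_sum; apply: eq_bigr => i _.
  have [-> |kK] := cK l i; first by rewrite !linear0.
  have [st nt] := ngenP (ltnW (ltn_ord l) : (l <= k.+1)%N) kn (ltn_ord i).
  by apply: dot_bface => j; rewrite (gen_face _ uK) ?st.
rewrite [nat_of_ord ord_max]/=; have [-> |kK] := cK k.+1 i; first by rewrite !linear0.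
have [st nt] := ngenP (leqnn k.+1) kn (ltn_ord i).
have H j : pull (skip j) (ngen u n k.+1 i k.+1) = if (j < k.+1)%N then 0 else 0.
  by rewrite (gen_face _ uK) ?st // gen_small ?st ?ltnS ?leqnn.
by rewrite (dot_bface _ _ H) bface_small // linear0.
Qed.

(** For [l > 0] a generator starts with a pair, whose two words have the same standardization. *)
Lemma std_comb (u : forall n k, freemod R (word k n)) n k c : (k.*2 <= n.+1)%N ->
  std_map (comb u n k c) = dot (std_map (u n k)) (c 0 0)%N.
Proof.
move=> kn; have stdd (G : freemod R (word k n)) b : std_map (dot G b) = dot (std_map G) b.
  by apply: dot_comm => s v; apply: std_map_pull.
rewrite /comb big_ord_recl linearD [X in _ + X]linear_sum [X in _ + X]big1 => [|l _].
  rewrite addr0 (_ : binom_diff n ord0 = 1%N) ?big_ord1; last by rewrite /binom_diff bin0.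
  by rewrite stdd.
rewrite linear_sum big1 // => i _; rewrite stdd.
have lk : (lift ord0 l <= k)%N by rewrite -ltnS.
have [] := ngenP lk kn (ltn_ord i).
rewrite /ngen; case: (nth _ _ _) => // x t _.
clear stdd; case: n kn i => [|[|n]] //= kn i _; case: k c kn l i lk => [|k] c kn l i lk.
- by case: l i lk.
- by rewrite gen_cons std_map_ins dot0.
Qed.

Lemma spanning_norm (u : forall n k, freemod R (word k n)) K n k (v : freemod R (word k n)) :
    admissible u K -> (k <= K)%N -> (k.*2 <= n.+1)%N ->
  exists c, v = comb u n k c /\
    forall l i, ~~ ((l <= k) && (i < binom_diff n l))%N -> c l i = 0.
Proof.
move=> uK kK kn; have [c ->] := spanning uK v kK kn.
exists (fun l i => if (l <= k)%N && (i < binom_diff n l)%N then c l i else 0).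
split=> [|l i /negPf-> //]; apply: eq_bigr => l _; apply: eq_bigr => i _.
by rewrite ltn_ord -ltnS ltn_ord.
Qed.

Lemma invariant_extension (u : forall n k, freemod R (word k n)) r n :
    admissible u r -> (r.+1.*2 <= n.+1)%N ->
  exists2 v : freemod R (word r.+1 n), (forall i, pull (skip i) v = u n r) &
    std_map v = delta (inj_id _).
Proof.
move=> uK rn; have rn' : (r.+1 <= n)%N by lia.
have rn2 : (r.*2 <= n.+1)%N by lia.
set w := widen_word rn'.
(* The deletions that a correction of the increasing word [w] must have. *)
pose beta (i : 'I_r.+1) := u n r - pull (skip i) (delta w).
have std_beta i : std_map (beta i) = 0.
  rewrite linearB (proj2 uK) // pull_delta std_map_delta.
  have -> : std (w \oi skip i) = inj_id _.
    rewrite -[skip i]inj_comp_id std_mono ?std_mono ?std_perm //; first exact: skip_mono.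
    by move=> x y; rewrite !widen_wordE.
  by rewrite subrr.
have [b bP] := choice (fun i => spanning_norm (beta i) uK (leqnn r) rn2).
have bE i := proj1 (bP i); have b0 i := proj2 (bP i); clear bP.
(* The [B_0] component is read off by [std_map], which kills [beta i]. *)
have b00 i m : b i 0%N m = 0.
  case: m => [|m]; last by apply: b0; rewrite /binom_diff bin0.
  have := std_beta i; rewrite bE std_comb // (proj2 uK) //.
  by rewrite (@dot_id _ 'I_r).
suff [c cb] : exists c, forall l m i, bface l i (c l m) = b i l m.
  (* The summand [l = 0] is dropped, as its generator is [u] in degree [r + 1], where nothing is
     known yet. For [l > 0] the pairs leave [u] in degree at most [r]. *)
  pose c' l m := if l == 0%N then 0 else c l m.
  have c'b l m i : bface l i (c' l m) = b i l m.
    by rewrite /c'; case: eqP => [->|_ //]; rewrite linear0 b00.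
  exists (delta w + comb u n r.+1 c') => [i|].
    rewrite linearD (comb_face _ uK) // => [|l m]; last first.
      by rewrite /c'; case: eqP => [->|l0]; [left | right; lia].
    have -> : comb u n r (fun l m => bface l i (c' l m)) = beta i.
      by rewrite bE; apply: eq_bigr => l _; apply: eq_bigr => m _; rewrite c'b.
    by rewrite addrC subrK.
  rewrite linearD std_comb // linear0 addr0 std_map_delta.
  by rewrite -[w]inj_comp_id std_widen.
have bc l m : exists c, forall i, bface l i c = b i l m.
  (* [bface_fill] starts in degree two; when filling to degree one, all coefficients are zero. *)
  case: r rn rn' rn2 w @beta std_beta b bE b0 b00 uK
    => [|r] rn rn' rn2 w beta std_beta b bE b0 b00 uK.
    exists 0 => i; rewrite linear0; case: l => [|l]; first by rewrite b00.
    by rewrite b0.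
  apply: bface_fill => [rl i|i j i' j' ei ej]; first by apply: b0; rewrite leqNgt rl.
  have [lm|lm] := boolP ((l <= r) && (m < binom_diff n l))%N; last first.
    have [rl|lr] := ltnP r l; first by rewrite !bface_small.
    by rewrite lr /= in lm; rewrite !b0 ?linear0 // negb_and lm orbT.
  have kn : (r.*2 <= n.+1)%N by lia.
  have Eb (p q : 'I_r.+2) p' : pull (skip p') (beta q) =
      comb u n r (fun l m => bface l p' (b q l m)).
    by rewrite bE (comb_face _ uK) // => *; right; rewrite ltn_addr.
  apply/eqP; rewrite -subr_eq0; apply/eqP; case/andP: lm => lr mn.
  (* Coefficients in degree [r] are unique, so their compatibility follows from that of [beta]: its
     double deletions are [u n r] minus the same word. *)
  apply: (comb_inj (u := u) (c := fun l m => bface l i' (b j l m) - bface l j' (b i l m))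
            uK _ kn _ lr mn); first exact: leqnSn.
  have Ep (q : 'I_r.+2) p' : pull (skip p') (beta q) = u n r - pull (skip q \oi skip p') (delta w).
    by rewrite linearB (proj1 uK) // -pull_comp.
  by rewrite combB -!Eb // !Ep (lift_lift ei ej) subrr.
have bc' x := bc x.1 x.2; have [c cb] := choice bc'.
by exists (fun l m => c (l, m)) => l m; apply: cb (l, m).
Qed.

Lemma admissible_exists K : exists u : forall n k, freemod R (word k n), admissible u K.
Proof.
elim: K => [|K [u uK]].
  exists (fun n k => if k is 0 then delta (widen_word (leq0n n)) else 0).
  split=> // n [|k] //= _ _; rewrite std_map_delta; congr delta.
  by apply: inj_ext => -[].
have H n : exists v : freemod R (word K.+1 n), (K.+1.*2 <= n.+1)%N ->
    (forall i, pull (skip i) v = u n K) /\ std_map v = delta (inj_id _).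
  have [Kn|nK] := leqP K.+1.*2 n.+1; last by exists 0.
  by have [v v1 v2] := invariant_extension uK Kn; exists v.
pose v n := projT1 (cid (H n)); have vP n := projT2 (cid (H n)).
(* Only degree [K + 1] is redefined; the new element is transported along [K.+1 = k]. *)
pose u' n k := if @eqP _ K.+1 k is ReflectT e then
  eq_rect _ (fun k => freemod R (word k n)) (v n) _ e else u n k.
have u'E n k : (k <= K)%N -> u' n k = u n k.
  by rewrite /u' => kK; case: eqP => // e; rewrite -e ltnn in kK.
have u'K n : u' n K.+1 = v n.
  by rewrite /u'; case: eqP => // e; rewrite (eq_irrelevance e erefl).
exists u'; split=> n k.
  rewrite ltnS leq_eqVlt => /predU1P[->|kK] kn i.
    by rewrite u'K u'E //; apply: (proj1 (vP n kn)).
  by rewrite !u'E //; [apply: (proj1 uK) | apply: ltnW].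
rewrite leq_eqVlt => /predU1P[->|kK] kn; first by rewrite u'K; apply: (proj2 (vP n kn)).
by rewrite u'E //; apply: (proj2 uK).
Qed.

End Compatible.

(** * Matrix units *)

Section Coordinates.
Variables (R : comPzRingType) (d : nat) (u : forall n k, freemod R (word k n)).
Hypothesis ud : admissible u d.

(** The bounds stand under the existential so that coefficients can be chosen for every word and
    extended linearly. Vanishing outside the range makes them unique. *)
Fact coord_subproof n k (w : word k n) : exists c : nat -> nat -> freemod R (word k k),
  (k <= d)%N -> (k.*2 <= n.+1)%N -> delta w = comb u n k c /\
    forall l i, ~~ ((l <= k) && (i < binom_diff n l))%N -> c l i = 0.
Proof.
have [kd|dk] := leqP k d; last by exists (fun _ _ => 0).
have [kn|nk] := leqP k.*2 n.+1; last by exists (fun _ _ => 0).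
by have [c cP] := spanning_norm (delta w) ud kd kn; exists c.
Qed.

Definition coord n k l i : {linear freemod R (word k n) -> freemod R (word k k)} :=
  lin (fun w => projT1 (cid (coord_subproof w)) l i).
Arguments coord {n k} l i : simpl never.

Lemma coord0 n k l i (v : freemod R (word k n)) : (k <= d)%N -> (k.*2 <= n.+1)%N ->
  ~~ ((l <= k) && (i < binom_diff n l))%N -> coord l i v = 0.
Proof.
move=> kd kn H; apply: (@freemod_ext _ _ _ (coord l i) \0) => w.
by rewrite lin_delta; case: cid => c cP /=; apply: (proj2 (cP kd kn)).
Qed.

Lemma comb_lin n k e (T : finType) (F : T -> nat -> nat -> freemod R (word k k)) v :
  comb u n e (fun l i => lin (fun w => F w l i) v) = lin (fun w => comb u n e (F w)) v.
Proof.
rewrite linE /comb; under [RHS]eq_bigr do rewrite scaler_sumr.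
rewrite [RHS]exchange_big; apply: eq_bigr => l _; under [RHS]eq_bigr do rewrite scaler_sumr.
rewrite [RHS]exchange_big; apply: eq_bigr => i _; rewrite linE linear_sum.
by apply: eq_bigr => w _; rewrite linearZ_LR.
Qed.

Lemma coordK n k (v : freemod R (word k n)) : (k <= d)%N -> (k.*2 <= n.+1)%N ->
  comb u n k (fun l i => coord l i v) = v.
Proof.
move=> kd kn; rewrite (@comb_lin _ _ _ _ (fun w => projT1 (cid (coord_subproof w)))).
apply: (@freemod_ext _ _ _ (lin _) idfun) => w; rewrite lin_delta.
by case: cid => c cP /=; rewrite -(proj1 (cP kd kn)).
Qed.

Lemma coord_unique n k (v : freemod R (word k n)) c : (k <= d)%N -> (k.*2 <= n.+1)%N ->
    v = comb u n k c -> (forall l i, ~~ ((l <= k) && (i < binom_diff n l))%N -> c l i = 0) ->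
  forall l i, coord l i v = c l i.
Proof.
move=> kd kn vc c0 l i; have [/andP[lk il]|H] := boolP ((l <= k) && (i < binom_diff n l))%N.
  apply/eqP; rewrite -subr_eq0; apply/eqP.
  apply: (comb_inj (c := fun l i => coord l i v - c l i) ud kd kn _ lk il).
  by rewrite combB coordK // -vc subrr.
by rewrite coord0 // c0.
Qed.

Lemma coord_pull n k s (v : freemod R (word k n)) l i : (k <= d)%N -> (k.*2 <= n.+1)%N ->
  coord l i (pull s v) = pull s (coord l i v).
Proof.
move=> kd kn; apply: (@coord_unique _ _ _ (fun l i => pull s (coord l i v))) => // [|l' i' H].
  by rewrite -comb_pull coordK.
by rewrite coord0 // linear0.
Qed.

Lemma coord_face n k p (v : freemod R (word k.+1 n)) l i : (k < d)%N -> (k.+1.*2 <= n.+1)%N ->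
  coord l i (pull (skip p) v) = bface l p (coord l i v).
Proof.
move=> kd kn; apply: (@coord_unique _ _ _ (fun l i => bface l p (coord l i v))).
- exact: ltnW.
- by lia.
- by rewrite -(comb_face _ ud) ?coordK // => *; right; rewrite ltn_addr.
move=> l' i' H; have [kl|lk] := ltnP k l'; first exact: bface_small.
rewrite lk /= in H; rewrite coord0 ?linear0 //.
by rewrite negb_and H orbT.
Qed.

Lemma coord_dot n k l' i' c l i : (k <= d)%N -> (k.*2 <= n.+1)%N ->
    (l' <= k)%N -> (i' < binom_diff n l')%N ->
  coord l i (dot (ngen u n l' i' k) c) = if (l == l') && (i == i') then c else 0.
Proof.
move=> kd kn lk il.
apply: (@coord_unique _ _ _ (fun l i => if (l == l') && (i == i') then c else 0)) => //.
  have lk' : (l' < k.+1)%N by [].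
  rewrite /comb (bigD1 (Ordinal lk')) //= [X in _ = _ + X]big1 => [|m ml].
    rewrite (bigD1 (Ordinal il)) //= [X in _ = _ + X + _]big1 => [|j ji].
      by rewrite !eqxx !addr0.
    by rewrite -val_eqE /= in ji; rewrite (negPf ji) andbF linear0.
  by rewrite big1 // => i0 _; rewrite -val_eqE /= in ml; rewrite (negPf ml) linear0.
by move=> m j; case: ifP => // /andP[/eqP-> /eqP->]; rewrite lk il.
Qed.

(* The matrix unit factoring through the [i]-th copy of the [l]-th summand of
   [word - n] and the [i']-th copy of the same summand in [word - n']. *)
Definition unit_map n n' l i i' k : {linear freemod R (word k n) -> freemod R (word k n')} :=
  dot (ngen u n' l i' k) \o coord l i.
Arguments unit_map n n' l i i' k : simpl never.

Lemma unit_mapE n n' l i i' k v : unit_map n n' l i i' k v = dot (ngen u n' l i' k) (coord l i v).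
Proof. by []. Qed.

Lemma unit_map_pull n n' l i i' : (d.*2 <= n.+1)%N -> (d.*2 <= n'.+1)%N ->
    (l <= d)%N -> (i' < binom_diff n' l)%N ->
  forall k k' (f : word k k') (v : freemod R (word k' n)), (k' <= d)%N ->
  unit_map n n' l i i' k (pull f v) = pull f (unit_map n n' l i i' k' v).
Proof.
move=> dn dn' ld il k k' f; apply: (word_gen (Q := fun k k' (f : word k k') =>
  forall v : freemod R (word k' n), (k' <= d)%N ->
  unit_map n n' l i i' k (pull f v) = pull f (unit_map n n' l i i' k' v))) => {k k' f}.
- move=> k s v kd; rewrite !unit_mapE coord_pull //; last by lia.
  by rewrite dot_pull.
- move=> k p v kd; rewrite !unit_mapE coord_face //; last by lia.
  apply: esym; apply: dot_bface => j.
  have ln : (l.*2 <= n'.+1)%N by lia.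
  have [st nt] := ngenP (leqnn l) ln il.
  rewrite (gen_face _ ud) ?st //; [by rewrite ltn_addr | by lia].
- move=> k m m' f g IHf IHg v md; have mm : (m <= d)%N := leq_trans (word_leq g) md.
  by rewrite (pull_comp f g v) (IHf _ mm) (IHg _ md) -(pull_comp f g).
Qed.

Lemma unit_map_comp n n' n'' l i j l' i' j' k v :
    (d.*2 <= n.+1)%N -> (d.*2 <= n'.+1)%N -> (d.*2 <= n''.+1)%N -> (k <= d)%N ->
    (j < binom_diff n' l)%N ->
  unit_map n' n'' l' i' j' k (unit_map n n' l i j k v) =
    if (l' == l) && (i' == j) then unit_map n n'' l i j' k v else 0.
Proof.
move=> dn dn' dn'' kd jl; rewrite !unit_mapE.
have [lk|kl] := leqP l k.
  rewrite coord_dot //; last by lia.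
  by case: ifP => [/andP[/eqP-> _] //|_]; rewrite linear0.
have -> : coord l i v = 0 by apply: coord0 => //; [lia | rewrite leqNgt kl].
by rewrite !linear0 if_same.
Qed.

Lemma sum_unit_map n k (v : freemod R (word k n)) : (d.*2 <= n.+1)%N -> (k <= d)%N ->
  \sum_(l < d.+1) \sum_(i < binom_diff n l) unit_map n n l i i k v = v.
Proof.
move=> dn kd; have kn : (k.*2 <= n.+1)%N by lia.
rewrite -[RHS](coordK _ kd kn) /comb.
rewrite (big_ord_widen _ (fun l => \sum_(i < binom_diff n l)
  dot (ngen u n l i k) (coord l i v)) (kd : (k < d.+1)%N)).
rewrite [RHS]big_mkcond; apply: eq_bigr => l _; case: ltnP => // kl.
by rewrite big1 // => i _; rewrite unit_mapE coord0 ?linear0 // negb_and -ltnNge kl.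
Qed.

End Coordinates.
Arguments unit_map {R d u} ud n n' l i i' k : simpl never.

(** * The action on a presented module *)

Section DirectSums.
Variables (R : pzRingType) (J : Type) (V : J -> lmodType R).

Definition single_fun j (v : V j) j' : V j' :=
  if pselect (j = j') is left e then eq_rect j (fun j => V j) v j' e else 0.

Lemma single_at j (v : V j) : single_fun v j = v.
Proof. by rewrite /single_fun; case: pselect => // e; rewrite (Prop_irrelevance e erefl). Qed.

Lemma single_other j (v : V j) j' : j <> j' -> single_fun v j' = 0.
Proof. by rewrite /single_fun; case: pselect. Qed.

Fact single_finite j (v : V j) : finite_set [set j' | single_fun v j' != 0].
Proof.
apply: (@sub_finite_set _ _ [set j]) => [j'|]; last exact: finite_set1.
by rewrite /single_fun /=; case: pselect => [e _|_]; [exact: esym | rewrite eqxx].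
Qed.
Definition single j (v : V j) : dsum V := DSum (single_finite v).

Fact single_is_linear j : linear (@single j).
Proof.
move=> a v w; apply: dsumP => j'; rewrite /= /single_fun.
by case: pselect => [e|_]; [case: _ / e | rewrite scaler0 addr0].
Qed.
HB.instance Definition _ j :=
  GRing.isLinear.Build R (V j) (dsum V) _ (@single j) (@single_is_linear j).

Definition component j (x : dsum V) : V j := x j.
Fact component_is_linear j : linear (component j).
Proof. by []. Qed.
HB.instance Definition _ j :=
  GRing.isLinear.Build R (dsum V) (V j) _ (component j) (@component_is_linear j).

(** Induction on a list containing the support, splitting off one component at a time. *)
Lemma dsum_ind_single (P : dsum V -> Prop) :
    P 0 -> (forall x y, P x -> P y -> P (x + y)) -> (forall j (v : V j), P (single v)) ->
  forall x, P x.
Proof.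
move=> P0 PD Ps x.
have [s sx] : exists s : seq J, forall j, x j != 0 -> List.In j s.
  have /(@finite_seqP {classic J})[s E] := dsum_finite x.
  exists s => j xj; have : [set` s] j by rewrite -E.
  rewrite /=; elim: s {E} => //= k s IHs; rewrite in_cons.
  by case/predU1P => [->|/IHs]; [left | right].
elim: s x sx => [|j s IHs] x sx.
  suff -> : x = 0 by [].
  by apply: dsumP => j; apply/eqP; apply: contraT => /sx.
rewrite -[x](subrK (single (x j))); apply: PD => //; apply: IHs => j'.
rewrite /=; have [<-|jj] := pselect (j = j'); first by rewrite single_at subrr eqxx.
by rewrite single_other // subr0 => /sx[].
Qed.

End DirectSums.

(** * Matrix units acting on the cokernel of a presentation *)

Section Splitting.
Variables (R : comPzRingType) (d : nat).

Lemma free_mapE (S T : finType) k (f : inj S T) (v : free_obj R k S) :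
  free_map f v = push f (v : freemod R (inj 'I_k S)).
Proof.
apply/ffunP => h; rewrite ffunE linE sum_ffunE big_mkcond /=.
apply: eq_bigr => g _; rewrite !ffunE.
by case: eqP => _; rewrite /GRing.scale /= ?mulr1 ?mulr0.
Qed.

Variables (u : forall n k, freemod R (word k n)) (ud : admissible u d).
Variables (I J : Type) (a : I -> nat) (b : J -> nat).
Variable p : FIhom (dsum_FI (fun j : J => free_FI R (b j)))
                   (dsum_FI (fun i : I => free_FI R (a i))).
Hypothesis bd : forall j, (b j <= d)%N.

Definition relator j : dsum (fun i => free_FI R (a i) 'I_(b j)) :=
  p 'I_(b j) (@single _ _ (fun j' => free_FI R (b j') 'I_(b j)) j (delta (inj_id 'I_(b j)))).

(** Yoneda: a map out of a free module is determined by the image [relator j] of the identity. Hence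
    [p] acts on words through [pull] alone, and commutes with whatever commutes with [pull]. *)
Lemma hom_single j n (v : freemod R (word (b j) n)) i :
  p 'I_n (@single _ _ (fun j' => free_FI R (b j') 'I_n) j v) i =
    lin (fun f => pull f v) (relator j i : freemod R (word (a i) (b j))).
Proof.
pose F : {linear freemod R (word (b j) n) -> freemod R (word (a i) n)} :=
  @component _ _ (fun i => free_FI R (a i) 'I_n) i \o
  (p 'I_n \o @single _ _ (fun j' => free_FI R (b j') 'I_n) j).
suff Fd w : F (delta w) = lin (fun f => delta (w \oi f)) (relator j i : freemod R _).
  rewrite -[LHS]/(F v) [in LHS](freemod_delta v) linear_sum.
  rewrite [RHS]linE; under [RHS]eq_bigr => f _ do rewrite linE scaler_sumr.
  rewrite exchange_big; apply: eq_bigr => w _; rewrite linearZ_LR Fd linE scaler_sumr.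
  by apply: eq_bigr => f _; rewrite !scalerA mulrC.
have E : @single _ _ (fun j' => free_FI R (b j') 'I_n) j (delta w) =
    fi_map (dsum_FI (fun j => free_FI R (b j))) w
      (@single _ _ (fun j' => free_FI R (b j') 'I_(b j)) j (delta (inj_id _))).
  apply: dsumP => j' /=; rewrite /single_fun; case: pselect => [e|_]; last first.
    by apply: esym; apply: (linear0 (free_map w)).
  by case: _ / e => /=; rewrite free_mapE push_delta inj_comp_id.
rewrite /F /= /component E fi_hom_natural -/(relator j) /=.
by rewrite free_mapE.
Qed.

Section UnitAction.
Variables (n n' l i0 i1 : nat).
Hypotheses (dn : (d.*2 <= n.+1)%N) (dn' : (d.*2 <= n'.+1)%N) (ld : (l <= d)%N)
  (il : (i1 < binom_diff n' l)%N).

Let E k : {linear free_FI R k 'I_n -> free_FI R k 'I_n'} := unit_map ud n n' l i0 i1 k.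

Lemma hom_unit (x : dsum (fun j => free_FI R (b j) 'I_n)) :
  dsum_map (fun i => E (a i)) (p 'I_n x) = p 'I_n' (dsum_map (fun j => E (b j)) x).
Proof.
elim/dsum_ind_single: x => [|x y Ex Ey|j v]; first by rewrite !linear0.
  by rewrite !linearD; exact: (congr2 +%R Ex Ey).
have -> : dsum_map (fun j => E (b j)) (single v) =
    @single _ _ (fun j' => free_FI R (b j') 'I_n') j (E (b j) v).
  apply: dsumP => j'; rewrite -[LHS]/(E (b j') (single_fun v j')).
  rewrite -[RHS]/(@single_fun _ _ (fun j' => free_FI R (b j') 'I_n') j (E (b j) v) j').
  rewrite /single_fun; case: pselect => [e|_]; last by rewrite linear0.
  by case: _ / e.
apply: dsumP => i; rewrite hom_single -[LHS]/(E (a i) (p 'I_n (single v) i)) hom_single.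
rewrite !linE linear_sum; apply: eq_bigr => f _; rewrite linearZ_LR.
by congr (_ *: _); apply: (unit_map_pull ud).
Qed.

Definition unit_action : {linear coker (p 'I_n) -> coker (p 'I_n')} := coker_map hom_unit.

Lemma unit_actionE x : unit_action (coker_pi (p 'I_n) x) =
  coker_pi (p 'I_n') (dsum_map (fun i => E (a i)) x).
Proof. exact: coker_mapE. Qed.

End UnitAction.

Hypothesis ad : forall i, (a i <= d)%N.

Lemma unit_action_comp n n' n'' l i j j' dn dn' dn'' ld jl jl' jl'' w :
  @unit_action n' n'' l j j' dn' dn'' ld jl' (@unit_action n n' l i j dn dn' ld jl w) =
  @unit_action n n'' l i j' dn dn'' ld jl'' w.
Proof.
have [x <-] := coker_pi_surj w; rewrite !unit_actionE; congr coker_pi.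
apply: dsumP => k; have := unit_map_comp ud i l j j' (x k) dn dn' dn'' (ad k) jl.
by rewrite !eqxx.
Qed.

Lemma unit_action_comp0 n n' n'' l l' i j i' j' dn dn' dn'' ld ld' jl jl' w :
    ~~ ((l' == l) && (i' == j)) ->
  @unit_action n' n'' l' i' j' dn' dn'' ld' jl' (@unit_action n n' l i j dn dn' ld jl w) = 0.
Proof.
move=> /negPf lj; have [x <-] := coker_pi_surj w; rewrite !unit_actionE.
rewrite -[RHS](linear0 (coker_pi (p 'I_n''))); congr coker_pi.
apply: dsumP => k; have := unit_map_comp ud i l' i' j' (x k) dn dn' dn'' (ad k) jl.
by rewrite lj.
Qed.

Lemma sum_unit_action n dn (ld : forall l : 'I_d.+1, (l <= d)%N) w :
  \sum_(l < d.+1) \sum_(i < binom_diff n l)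
    @unit_action n n l i i dn dn (ld l) (ltn_ord i) w = w.
Proof.
have [x <-] := coker_pi_surj w.
under eq_bigr => l _ do under eq_bigr => i _ do rewrite unit_actionE.
under eq_bigr => l _ do rewrite -linear_sum.
rewrite -linear_sum; congr coker_pi; apply: dsumP => k.
rewrite -[LHS]/(component k _) linear_sum.
rewrite -[RHS](sum_unit_map ud (x k) dn (ad k)); apply: eq_bigr => l _.
by rewrite linear_sum.
Qed.

End Splitting.

(** * Decomposing a module by matrix units *)

Section IsoOfUnits.
Variables (R : comPzRingType) (V W : lmodType R) (L : finType) (m : L -> nat).
Variables (e : L -> {linear W -> W}).
Variables (f : forall l, 'I_(m l) -> {linear V -> W}) (g : forall l, 'I_(m l) -> {linear W -> V}).

(** The image of the idempotent [e l] is modelled as the cokernel of its complement. *)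
Definition one_sub l : {linear W -> W} := idfun \- e l.

Hypothesis fg : forall l i w, f i (g (i : 'I_(m l)) w) = e l w.
Hypothesis fg_i : forall l (i j : 'I_(m l)) w, i != j -> f i (g j w) = 0.
Hypothesis fg_l : forall l l' (i : 'I_(m l)) (j : 'I_(m l')) w, l != l' -> f i (g j w) = 0.
Hypothesis ge : forall l (i : 'I_(m l)) w, g i (e l w) = g i w.
Hypothesis gf : forall v, \sum_l \sum_(i < m l) g i (f i v) = v.

Let D := dsum (fun l => dsum (fun _ : 'I_(m l) => coker (one_sub l))).

Definition split_map (v : V) : D :=
  @DSum _ _ (fun l => dsum (fun _ : 'I_(m l) => coker (one_sub l)))
    (fun l => @DSum _ _ (fun _ : 'I_(m l) => coker (one_sub l))
      (fun i => coker_pi (one_sub l) (f i v)) (@finite_finset _ _)) (@finite_finset _ _).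

Fact split_map_is_linear : linear split_map.
Proof. by move=> c v w; apply: dsumP => l; apply: dsumP => i; rewrite /= !linearP. Qed.
HB.instance Definition _ := GRing.isLinear.Build R V D _ split_map split_map_is_linear.

Definition unsplit_map (x : D) : V := \sum_l \sum_(i < m l) g i (coker_repr (x l i)).

Lemma g_repr l (i : 'I_(m l)) w : g i (coker_repr (coker_pi (one_sub l) w)) = g i w.
Proof.
have /coker_piP[z zw] := coker_reprK (coker_pi (one_sub l) w).
apply/eqP; rewrite -subr_eq0 -linearB -zw; apply/eqP.
by rewrite /one_sub /= linearB /= ge subrr.
Qed.

(** By [ge] the maps [g] are well defined on the cokernels. Then [gf] gives one composite, and the
    relations for [f] after [g] the other, as [e l w] and [w] agree in the cokernel. *)
Lemma split_iso : lmod_iso V D.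
Proof.
exists split_map; exists unsplit_map => [v|x].
  rewrite -[RHS]gf; apply: eq_bigr => l _; apply: eq_bigr => i _.
  exact: g_repr.
apply: dsumP => l; apply: dsumP => i; rewrite /= /unsplit_map linear_sum (bigD1 l) //=.
rewrite linear_sum (bigD1 i) //= fg big1 => [|j ji]; last by rewrite fg_i // eq_sym.
rewrite big1 => [|l' ll]; last first.
  by rewrite linear_sum big1 // => j _; rewrite fg_l // eq_sym.
rewrite !addr0 -[RHS]coker_reprK; apply/coker_piP.
by exists (- coker_repr (x l i)); rewrite linearN /one_sub /= opprB.
Qed.

End IsoOfUnits.

(** * Assembling the decomposition of a presented module *)

Lemma binom_diff_gt0 d l : (l <= d)%N -> (0 < binom_diff (2 * d) l)%N.
Proof.
move=> ld; have ld2 : (l.*2 <= 2 * d)%N by lia.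
rewrite -size_norms; last by lia.
(* The list of zeros pairs the first [2 l] letters consecutively. *)
suff: nseq l 0%N \in norms l (2 * d) 0 by case: norms.
rewrite mem_norms size_nseq eqxx /=; elim: l (2 * d)%N ld2 {ld} => // l IHl [|[|n]] //= ln.
by apply: IHl; lia.
Qed.

Lemma lmod_iso_trans (R : pzRingType) (U V W : lmodType R) :
  lmod_iso U V -> lmod_iso V W -> lmod_iso U W.
Proof. by move=> [f bf] [g bg]; exists (g \o f); apply: bij_comp. Qed.

Theorem theoremA (R : comPzRingType) (d : nat) (M : FImod R)
    (hM : presented_in_degrees d M) :
  exists A : 'I_d.+1 -> lmodType R,
    forall n : nat, (2 * d - 1 <= n)%N ->
      lmod_iso (M 'I_n)
        (dsum (fun l : 'I_d.+1 => dsum (fun _ : 'I_(binom_diff n l) => A l))).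
Proof.
have [I [J [a [b [p [ad bd [q [q' qK]]]]]]]] := hM.
have [u ud] := admissible_exists R d.
have dn0 : (d.*2 <= (2 * d).+1)%N by lia.
have ld (l : 'I_d.+1) : (l <= d)%N by rewrite -ltnS.
have i0 (l : 'I_d.+1) := binom_diff_gt0 (ld l).
pose act n n' l i i' dn dn' ld il := @unit_action R d u ud I J a b p bd n n' l i i' dn dn' ld il.
(* Each [A l] is the image of a diagonal matrix unit on the module at [2 * d] letters, where every
   [B_l] with [l <= d] has a copy with index 0. For [d > 0] the bound [2 * d - 1] would not do as a
   reference point: there [binom_diff] vanishes at [l = d]. *)
pose e (l : 'I_d.+1) := act _ _ l 0%N 0%N dn0 dn0 (ld l) (i0 l).
exists (fun l => coker (one_sub e l)) => n n_ge.
have dn : (d.*2 <= n.+1)%N by lia.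
have qiso : lmod_iso (M 'I_n) (coker (p 'I_n)).
  by exists (q 'I_n); have [qq' q'q] := qK 'I_n; exists (q' 'I_n).
apply: lmod_iso_trans qiso _.
apply: (@split_iso _ _ _ _ _ e (fun l i => act _ _ l i 0%N dn dn0 (ld l) (i0 l))
  (fun l i => act _ _ l 0%N i dn0 dn (ld l) (ltn_ord i))).
- by move=> l i w; apply: unit_action_comp.
- by move=> l i j w ij; apply: unit_action_comp0; rewrite // eqxx.
- by move=> l l' i j w ll; apply: unit_action_comp0; rewrite // negb_and ll.
- by move=> l i w; apply: unit_action_comp.
move=> v; rewrite -[RHS](sum_unit_action ud bd ad dn ld); apply: eq_bigr => l _.
by apply: eq_bigr => i _; apply: unit_action_comp.
Qed.
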